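(* Let $m=2n$ be even with $n\ge 2$, let $A\in Z_m([a,b])$ be a Shin--Zettl matrix of order $m$ on the finite interval $[a,b]$ with $A=A^+$, and let $L_{\max}$ be the associated maximal operator in $L_2([a,b],\mathbb{C})$. Let $K$ be a $2n\times 2n$ complex matrix (a linear operator on $\mathbb{C}^{2n}$), and let $L_K$ and $L^K$ be the restrictions of $L_{\max}$ to the sets of $y\in\operatorname{Dom}(L_{\max})$ satisfying respectively $$(K-I)\Gamma_{[1]}y+i(K+I)\Gamma_{[2]}y=0\quad\text{(for }L_K),\qquad (K-I)\Gamma_{[1]}y-i(K+I)\Gamma_{[2]}y=0\quad\text{(for }L^K).$$ Then the boundary conditions defining $L_K$ (respectively, $L^K$) are separated if and only if $K$ has the block form $$K=\begin{pmatrix}K_a&0\\0&K_b\end{pmatrix},$$ where $K_a$ and $K_b$ are $n\times n$ matrices.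
   Context: Shin--Zettl matrices. $Z_m([a,b])$ is the set of $m\times m$ complex matrix-valued functions $A=(a_{k,s})$ on the finite interval $[a,b]$ such that $a_{k,s}\equiv 0$ for $s>k+1$, all entries $a_{k,s}\in L_1([a,b],\mathbb{C})$, and $a_{k,k+1}\ne 0$ a.e. on $[a,b]$ for $k=1,\dots,m-1$. Quasi-derivatives. Given $A$, define recursively $D^{[0]}y:=y$; $D^{[k]}y:=a_{k,k+1}^{-1}\bigl((D^{[k-1]}y)'-\sum_{s=1}^k a_{k,s}D^{[s-1]}y\bigr)$ for $k=1,\dots,m-1$; $D^{[m]}y:=(D^{[m-1]}y)'-\sum_{s=1}^m a_{m,s}D^{[s-1]}y$, on $\operatorname{Dom}(A):=\{y : D^{[k]}y\in AC([a,b],\mathbb{C}),\ k=0,\dots,m-1\}$. The quasi-differential expression is $l(y):=i^mD^{[m]}y$. Maximal operator in $L_2([a,b],\mathbb{C})$. $L_{\max}y=l(y)$ with $\operatorname{Dom}(L_{\max})=\{y\in\operatorname{Dom}(A): D^{[m]}y\in L_2([a,b],\mathbb{C})\}$. Formal adjoint. $A^+:=-\Lambda_m^{-1}\overline{A^T}\Lambda_m$, where $\Lambda_m$ is the $m\times m$ matrix whose only non-zero entries are $(\Lambda_m)_{j,m+1-j}=(-1)^j$, $j=1,\dots,m$. Boundary maps $\Gamma_{[1]},\Gamma_{[2]}:\operatorname{Dom}(L_{\max})\to\mathbb{C}^{2n}$: for $k=1,\dots,n$, $(\Gamma_{[1]}y)_k=i^{2n}(-1)^kD^{[2n-k]}y(a)$,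 $(\Gamma_{[1]}y)_{n+k}=i^{2n}(-1)^{k-1}D^{[2n-k]}y(b)$, $(\Gamma_{[2]}y)_k=D^{[k-1]}y(a)$, $(\Gamma_{[2]}y)_{n+k}=D^{[k-1]}y(b)$. Separated boundary conditions. For a continuous function $f$ on $[a,b]$ let $\mathbf{f_a}$ and $\mathbf{f_b}$ denote its germs at the points $a$ and $b$ (equality of germs means coincidence of the functions on some neighbourhood of the point in $[a,b]$). The boundary conditions defining an operator $L\subset L_{\max}$ are called separated if for any $y\in\operatorname{Dom}(L)$ and any $g,h\in\operatorname{Dom}(L_{\max})$ with $\mathbf{g_a}=\mathbf{y_a}$, $\mathbf{g_b}=0$, $\mathbf{h_a}=0$, $\mathbf{h_b}=\mathbf{y_b}$ one has $g,h\in\operatorname{Dom}(L)$. *)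

(* Defs.v *)
From HB Require Import structures.
From mathcomp Require Import all_boot all_order all_algebra.
From mathcomp Require Import all_classical all_reals all_analysis.
From mathcomp.real_closed Require Import complex.

Set Implicit Arguments.
Unset Strict Implicit.
Unset Printing Implicit Defensive.

Import Order.TTheory GRing.Theory Num.Theory.
Import numFieldNormedType.Exports.

Local Open Scope classical_set_scope.
Local Open Scope ring_scope.

(* Complex functions on [a, b] are represented by functions R -> R[i], and only
   their values on [a, b] are relevant. *)

Section function_classes.
Context {R : realType}.
Implicit Types (a b : R) (f g : R -> R[i]).

Definition ae_on a b (P : R -> Prop) : Prop :=
  {ae (@lebesgue_measure R), forall x, `[a, b]%classic x -> P x}.

Definition abs_cont a b f : Prop :=
  forall e : R, 0 < e -> exists2 d : R, 0 < d &
    forall (N : nat) (u v : 'I_N -> R),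
      (forall j, [/\ a <= u j, u j <= v j & v j <= b]) ->
      trivIset setT (fun j => `]u j, v j[%classic) ->
      \sum_(j < N) (v j - u j) < d ->
      \sum_(j < N) `|f (v j) - f (u j)| < e%:C%C.

(* The measurable sets of the measurable type R are the Borel sets, whereas
   the Lebesgue classes are defined up to null sets: f belongs to L_p when it
   coincides a.e. with a Borel function g such that |g|^p is integrable. *)
Definition in_Lp (p : nat) a b f : Prop :=
  exists g, [/\ ae_on a b (fun x => f x = g x),
    measurable_fun `[a, b]%classic (fun x => complex.Re (g x)),
    measurable_fun `[a, b]%classic (fun x => complex.Im (g x)) &
    (\int[@lebesgue_measure R]_(x in `[a, b]%classic)
        (complex.Re `|g x| ^+ p)%:E < +oo)%E].

(* Total, like derive1; meaningful where the derivative exists. *)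
Definition cderive f : R -> R[i] := fun x =>
  (derive1 (fun t => complex.Re (f t)) x +i*
   derive1 (fun t => complex.Im (f t)) x)%C.

(* The absolutely continuous function on [a, b] that is equal to f a.e., when
   there is one (it is unique on [a, b] for a < b), and f itself otherwise. *)
Definition ac_version a b f : R -> R[i] :=
  xget f [set g | abs_cont a b g /\ ae_on a b (fun x => g x = f x)].

Definition germ_eq a b (c : R) f g : Prop :=
  \forall x \near within `[a, b]%classic (nbhs c), f x = g x.

End function_classes.

(* Rows and columns are numbered from 0, i.e. A x k s is a_{k+1,s+1}(x). *)

Section quasi_derivatives.
Context {R : realType} {m : nat}.
Implicit Types (a b : R) (A : R -> 'M[R[i]]_m) (y : R -> R[i]).

Definition shin_zettl a b A : Prop :=
  [/\ forall k s : 'I_m, (k.+1 < s)%N -> ae_on a b (fun x => A x k s = 0),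
      forall k s : 'I_m, in_Lp 1 a b (fun x => A x k s) &
      forall k s : 'I_m, s = k.+1 :> nat -> ae_on a b (fun x => A x k s != 0)].

(* The entry with natural number indices, 0 if they are out of range. *)
Definition entry (M : 'M[R[i]]_m) (k s : nat) : R[i] :=
  if (insub k : option 'I_m, insub s : option 'I_m) is (Some k', Some s')
  then M k' s' else 0.

(* For d = [:: D^[0] y; ...; D^[k] y], the function
   (D^[k] y)' - \sum_(s <= k) a_{k+1,s+1} D^[s] y. *)
Definition qd_residue A (d : seq (R -> R[i])) (k : nat) : R -> R[i] := fun x =>
  cderive (nth (fun=> 0) d k) x -
  \sum_(s < k.+1) entry (A x) k s * nth (fun=> 0) d s x.

(* The sequence D^[0] y, ..., D^[k] y. The recursion formula determines D^[k] y
   (0 < k < m) a.e. only; being required to be absolutely continuous and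
   evaluated at points, it stands for its absolutely continuous version. *)
Fixpoint qd_seq a b A y (k : nat) : seq (R -> R[i]) :=
  if k isn't k'.+1 then [:: y] else
  let d := qd_seq a b A y k' in
  rcons d
    (if (k < m)%N
     then ac_version a b
            (fun x => (entry (A x) k' k)^-1 * qd_residue A d k' x)
     else qd_residue A d k').

Definition qderiv a b A y (k : nat) : R -> R[i] :=
  nth (fun=> 0) (qd_seq a b A y k) k.

Lemma size_qd_seq a b A y k : size (qd_seq a b A y k) = k.+1.
Proof. by elim: k => //= k IH; rewrite size_rcons IH. Qed.

Lemma nth_qd_seq a b A y k s : (s <= k)%N ->
  nth (fun=> 0) (qd_seq a b A y k) s = qderiv a b A y s.
Proof.
elim: k => [|k IH]; first by case: s.
rewrite leq_eqVlt => /orP[/eqP->//|sk] /=.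
by rewrite nth_rcons size_qd_seq sk IH.
Qed.

Lemma qderiv0 a b A y : qderiv a b A y 0 = y.
Proof. by []. Qed.

Lemma qd_residueE a b A y k : qd_residue A (qd_seq a b A y k) k =
  fun x => cderive (qderiv a b A y k) x -
           \sum_(s < k.+1) entry (A x) k s * qderiv a b A y s x.
Proof.
apply/funext => x; rewrite /qd_residue nth_qd_seq//; congr (_ - _).
by apply: eq_bigr => s _; rewrite nth_qd_seq// -ltnS.
Qed.

Lemma qderivS a b A y k : (k.+1 < m)%N ->
  qderiv a b A y k.+1 = ac_version a b (fun x => (entry (A x) k k.+1)^-1 *
    (cderive (qderiv a b A y k) x -
     \sum_(s < k.+1) entry (A x) k s * qderiv a b A y s x)).
Proof.
by move=> km; rewrite {1}/qderiv /= nth_rcons size_qd_seq ltnn eqxx km qd_residueE.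
Qed.

Lemma qderiv_last a b A y k : k.+1 = m ->
  qderiv a b A y k.+1 = fun x => cderive (qderiv a b A y k) x -
     \sum_(s < k.+1) entry (A x) k s * qderiv a b A y s x.
Proof.
move=> km; have mk : (k.+1 < m)%N = false by rewrite -km ltnn.
by rewrite {1}/qderiv /= nth_rcons size_qd_seq ltnn eqxx mk qd_residueE.
Qed.

Definition dom_expr a b A : set (R -> R[i]) :=
  [set y | forall k, (k < m)%N -> abs_cont a b (qderiv a b A y k)].

Definition qexpr a b A y : R -> R[i] := fun x =>
  'i%C ^+ m * qderiv a b A y m x.

Definition Lambda : 'M[R[i]]_m :=
  \matrix_(j, k) if (j + k.+1 == m)%N then (-1) ^+ j.+1 else 0.

Definition formal_adjoint (M : 'M[R[i]]_m) : 'M[R[i]]_m :=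
  - (invmx Lambda *m map_mx conjc M^T *m Lambda).

End quasi_derivatives.

Section operators.
Context {R : realType}.

Record operator := Operator {
  op_dom : set (R -> R[i]);
  op_act : (R -> R[i]) -> (R -> R[i]) }.

Definition restrict_op (L : operator) (D : set (R -> R[i])) : operator :=
  Operator (op_dom L `&` D) (op_act L).

Definition Lmax {m : nat} (a b : R) (A : R -> 'M[R[i]]_m) : operator :=
  Operator (dom_expr a b A `&` [set y | in_Lp 2 a b (qderiv a b A y m)])
           (qexpr a b A).

Definition separated_bc (a b : R) (Lm L : operator) : Prop :=
  forall y g h, op_dom L y -> op_dom Lm g -> op_dom Lm h ->
    germ_eq a b a g y -> germ_eq a b b g (fun=> 0) ->
    germ_eq a b a h (fun=> 0) -> germ_eq a b b h y ->
    op_dom L g /\ op_dom L h.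

End operators.

(* The order m = 2n is written n + n, to match the block decomposition of
   column vectors and matrices; k is numbered from 0. *)

Section boundary.
Context {R : realType} {n : nat}.
Implicit Types (a b : R) (A : R -> 'M[R[i]]_(n + n)) (K : 'M[R[i]]_(n + n)).

Definition Gamma1 a b A (y : R -> R[i]) : 'cV[R[i]]_(n + n) :=
  col_mx
    (\col_(k < n) ('i%C ^+ (n + n) * (-1) ^+ k.+1 *
                   qderiv a b A y (n + n - k.+1) a))
    (\col_(k < n) ('i%C ^+ (n + n) * (-1) ^+ k *
                   qderiv a b A y (n + n - k.+1) b)).

Definition Gamma2 a b A (y : R -> R[i]) : 'cV[R[i]]_(n + n) :=
  col_mx (\col_(k < n) qderiv a b A y k a) (\col_(k < n) qderiv a b A y k b).

Definition L_lower a b A K : operator :=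
  restrict_op (Lmax a b A)
    [set y | (K - 1%:M) *m Gamma1 a b A y
             + 'i%C *: ((K + 1%:M) *m Gamma2 a b A y) = 0].

Definition L_upper a b A K : operator :=
  restrict_op (Lmax a b A)
    [set y | (K - 1%:M) *m Gamma1 a b A y
             - 'i%C *: ((K + 1%:M) *m Gamma2 a b A y) = 0].

End boundary.

(* Main.v *)
Require Import Defs.
From mathcomp Require Import all_boot all_order all_algebra.
From mathcomp Require Import all_classical all_reals all_analysis.
From mathcomp.real_closed Require Import complex.
From mathcomp Require Import measurable_realfun ring lra.

(* With u = Gamma_1 y, v = Gamma_2 y and z = i or -i, the boundary condition reads
   K (u + z v) = u - z v. Replacing y by a function with germ y at a and 0 at b
   keeps the first halves of u and v and cancels the second ones, so the condition
   for a block diagonal K is separated. Conversely, if every pair (u, v) is attained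
   by a sum of a function vanishing near b and one vanishing near a, separation
   forces K to preserve the two halves of C^{2n}.

   Such functions are trajectories of the system w' = A w + f e_m, with a bounded
   control f = D^[m] w_1, steered from prescribed values to 0 on a short interval
   next to an endpoint. The interval is chosen so that A has a small integral
   there, hence Picard iteration converges. Controllability is proved by duality:
   if psi solves psi' = - psi A and f = conj psi_m steers w to 0, then
   \int |psi_m|^2 = - psi(a) w(a). Hence w(a) = 0 gives psi_m = 0, then
   psi_{m-1} = ... = psi_1 = 0 since a_{k,k+1} is nonzero a.e., and the linear map
   psi(a) |-> w(a) is bijective over R. *)

Set Implicit Arguments.
Unset Strict Implicit.
Unset Printing Implicit Defensive.

Import Order.TTheory GRing.Theory Num.Theory.
Import numFieldNormedType.Exports.

Local Open Scope classical_set_scope.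
Local Open Scope ring_scope.

(** * Primitives of integrable functions *)

Section primitives.
Context {R : realType}.
Notation mu := (@lebesgue_measure R).
Implicit Types f g : R -> R.

(* Coefficients living on [a, b] are extended by 0 to the whole line, so that all
   integrals start at -oo and trajectories are constant outside the support. *)
Definition integrableR f := mu.-integrable setT (EFin \o f).

Definition prim f (t : R) : R := \int[mu]_(x in `]-oo, t]) f x.

Lemma integrableR_on (D : set R) f :
  measurable D -> integrableR f -> mu.-integrable D (EFin \o f).
Proof. by move=> mD; exact: integrableS. Qed.

Lemma integrableRD f g : integrableR f -> integrableR g ->
  integrableR (fun x => f x + g x).
Proof. by move=> hf hg; have := integrableD measurableT hf hg. Qed.

Lemma integrableRZ (k : R) f : integrableR f -> integrableR (fun x => k * f x).
Proof. by move=> hf; have := integrableZl measurableT k hf. Qed.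

Lemma integrableRB f g : integrableR f -> integrableR g ->
  integrableR (fun x => f x - g x).
Proof. by move=> hf hg; have := integrableB measurableT hf hg. Qed.

Lemma integrableR0 : integrableR (fun=> 0).
Proof. exact: integrable0. Qed.

Lemma integrableR_sum (I : Type) (s : seq I) (F : I -> R -> R) :
  (forall i, integrableR (F i)) -> integrableR (fun x => \sum_(i <- s) F i x).
Proof.
move=> hF; elim: s => [|i s IH].
  by under eq_fun do rewrite big_nil; exact: integrableR0.
by under eq_fun do rewrite big_cons; exact: integrableRD.
Qed.

Lemma integrableR_measurable f : integrableR f -> measurable_fun setT f.
Proof. by move=> /(measurable_int mu)/measurable_EFinP. Qed.

Lemma integrableRM (M : R) f g : integrableR f -> measurable_fun setT g ->
  (forall x, `|g x| <= M) -> integrableR (fun x => f x * g x).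
Proof.
move=> hf mg gM.
apply: (@le_integrable _ _ _ mu _ measurableT _ (EFin \o (fun x => M * f x))).
- by apply/measurable_EFinP/measurable_funM => //; exact: integrableR_measurable.
- move=> x _ /=; rewrite lee_fin normrM mulrC normrM ler_wpM2r//.
  by rewrite (le_trans (gM x))// ler_norm.
- exact: integrableRZ.
Qed.

Lemma integrableR_norm f : integrableR f -> integrableR (fun x => `|f x|).
Proof. by move=> hf; have := integrable_norm hf. Qed.

Lemma integrableR_restrict (D : set R) f : measurable D ->
  mu.-integrable D (EFin \o f) -> integrableR (f \_ D).
Proof.
move=> mD hf; rewrite /integrableR -restrict_EFin.
by apply/integrable_restrict => //; rewrite setTI.
Qed.

Lemma RintD (D : set R) f g : measurable D -> integrableR f -> integrableR g ->
  \int[mu]_(x in D) (f x + g x) = \int[mu]_(x in D) f x + \int[mu]_(x in D) g x.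
Proof. by move=> mD hf hg; rewrite RintegralD//; apply: integrableR_on. Qed.

Lemma RintB f g : integrableR f -> integrableR g ->
  \int[mu]_x (f x - g x) = \int[mu]_x f x - \int[mu]_x g x.
Proof. by move=> hf hg; rewrite RintegralB. Qed.

Lemma RintZ (k : R) f : integrableR f ->
  \int[mu]_x (k * f x) = k * \int[mu]_x f x.
Proof. by move=> hf; rewrite RintegralZl. Qed.

Lemma Rint_sum (D : set R) (I : Type) (s : seq I) (F : I -> R -> R) :
  measurable D -> (forall i, integrableR (F i)) ->
  \int[mu]_(x in D) (\sum_(i <- s) F i x) =
  \sum_(i <- s) \int[mu]_(x in D) F i x.
Proof.
move=> mD hF; elim: s => [|i s IH].
  rewrite big_nil; under eq_Rintegral do rewrite big_nil.
  by rewrite Rintegral_cst// mul0r.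
under eq_Rintegral do rewrite big_cons.
by rewrite RintD ?big_cons ?IH//; exact: integrableR_sum.
Qed.

Lemma Rint_bound (D : set R) f g : measurable D -> integrableR f ->
  integrableR g -> (forall x, `|f x| <= g x) ->
  `|\int[mu]_(x in D) f x| <= \int[mu]_x g x.
Proof.
move=> mD hf hg fg.
have h : forall x, 0 <= g x by move=> x; exact: le_trans (fg x).
rewrite (le_trans (le_normr_Rintegral _ _))//; first exact: integrableR_on.
apply: (@le_trans _ _ (\int[mu]_(x in D) g x)).
  apply: le_Rintegral => //.
    by apply: integrableR_on => //; exact: integrableR_norm.
  exact: (integrableR_on mD hg).
rewrite [leLHS]Rintegral_mkcond; apply: le_Rintegral => //.
  exact/integrableR_restrict/integrableR_on.
by move=> x _; rewrite patchE; case: ifP.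
Qed.

Lemma primD f g t : integrableR f -> integrableR g ->
  prim (fun x => f x + g x) t = prim f t + prim g t.
Proof. exact: RintD. Qed.

Lemma primZ (k : R) f t : integrableR f ->
  prim (fun x => k * f x) t = k * prim f t.
Proof. by move=> hf; rewrite /prim RintegralZl//; exact: integrableR_on. Qed.

Lemma primB f g t : integrableR f -> integrableR g ->
  prim (fun x => f x - g x) t = prim f t - prim g t.
Proof. by move=> hf hg; rewrite /prim RintegralB//; exact: integrableR_on. Qed.

Lemma primB_itv f u v : integrableR f -> u <= v ->
  prim f v - prim f u = \int[mu]_(x in `]u, v[) f x.
Proof.
move=> hf uv; rewrite /prim Rintegral_itvB//; last exact: integrableR_on.
by rewrite Rintegral_itv_bndo_bndc//; exact: integrableR_on.
Qed.

(** The increments are bounded by the integral of [|f|] over the union of the intervals. By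
    disjointness this union has measure the sum of the lengths, so absolute continuity of the
    Lebesgue integral applies. *)
Lemma prim_ac f (e : R) : integrableR f -> 0 < e -> exists2 d : R, 0 < d &
  forall (N : nat) (u v : 'I_N -> R), (forall j, u j <= v j) ->
    trivIset setT (fun j => `]u j, v j[%classic) ->
    \sum_(j < N) (v j - u j) < d ->
    \sum_(j < N) `|prim f (v j) - prim f (u j)| < e.
Proof.
move=> hf e0; have [d [d0 hd]] := integral_normr_continuous hf e0.
exists d => // N u v uv tI sd.
pose D := \big[setU/set0]_(j < N) `]u j, v j[%classic.
have mD : measurable D by apply: bigsetU_measurable.
apply: (@le_lt_trans _ _ (\int[mu]_(x in D) `|f x|)); last first.
  apply: hd => //; rewrite /D measure_bigsetU_ord//=.
  under eq_bigr do rewrite lebesgue_measure_itv/=.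
  rewrite (eq_bigr (fun j => (v j - u j)%:E)); first by rewrite sumEFin lte_fin.
  move=> j _; rewrite lte_fin; case: ltP => // vu.
  by have -> : v j = u j; [apply/eqP; rewrite eq_le vu uv|rewrite subrr].
rewrite /Rintegral /D ge0_integral_bigsetU//=.
- rewrite -sum_fine; last first.
    move=> j _; apply: integrable_fin_num => //.
    by apply: integrableR_on => //; exact: integrableR_norm.
  apply: ler_sum => j _; rewrite primB_itv//.
  by apply: le_normr_Rintegral => //; exact: integrableR_on.
- exact: index_enum_uniq.
- exact: sub_trivIset tI.
- apply/measurable_EFinP; apply: measurable_funTS.
  by apply: integrableR_measurable; apply: integrableR_norm.
Qed.

Lemma prim_unif f (e : R) : integrableR f -> 0 < e -> exists2 d : R, 0 < d &
  forall u v, `|u - v| < d -> `|prim f u - prim f v| < e.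
Proof.
move=> hf e0; have [d d0 hd] := prim_ac hf e0; exists d => // u v.
wlog uv : u v / u <= v => [H uvd|].
  have [uv|vu] := leP u v; first exact: H.
  by rewrite distrC; apply: H; [exact: ltW|rewrite distrC].
rewrite distrC ger0_norm ?subr_ge0// => uvd.
have := hd 1%N (fun=> u) (fun=> v) (fun=> uv).
rewrite !big_ord1 distrC; apply=> //.
by move=> i j _ _ _; rewrite !ord1.
Qed.

Lemma prim_continuous f : integrableR f -> continuous (prim f).
Proof.
move=> hf x; apply/cvgrPdist_lt => e e0; have [d d0 hd] := prim_unif hf e0.
by exists d => // y /= /hd.
Qed.

Lemma prim_measurable f : integrableR f -> measurable_fun setT (prim f).
Proof. by move=> hf; apply: continuous_measurable_fun; exact: prim_continuous. Qed.

Lemma prim_bound f t : integrableR f -> `|prim f t| <= \int[mu]_x `|f x|.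
Proof. by move=> hf; apply: Rint_bound => //; exact: integrableR_norm. Qed.

Lemma prim_derive f : integrableR f ->
  {ae mu, forall x, derivable (prim f) x 1 /\ derive1 (prim f) x = f x}.
Proof.
move=> hf; apply: FTC1Ny; first by move=> y; exact: integrableR_on.
by apply: open_integrable_locally => //; exact: openT.
Qed.

Lemma prim_left f p t : (forall x, x <= p -> f x = 0) -> t <= p -> prim f t = 0.
Proof.
move=> f0 tp; rewrite /prim (@eq_Rintegral _ _ _ _ _ (fun=> 0)).
  by rewrite Rintegral_cst// mul0r.
by move=> x; rewrite inE/= in_itv/= => xt; rewrite f0// (le_trans xt).
Qed.

Lemma prim_right f q t : (forall x, q < x -> f x = 0) -> q <= t ->
  prim f t = \int[mu]_x f x.
Proof.
move=> f0 qt; rewrite /prim Rintegral_mkcond; apply: eq_Rintegral => x _.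
rewrite patchE; case: ifPn => //; rewrite notin_setE/= in_itv/= => /negP.
by rewrite -ltNge => tx; rewrite f0// (le_lt_trans qt).
Qed.

End primitives.

(** * Integration by parts through Fubini *)

Section by_parts.
Context {R : realType}.
Notation mu := (@lebesgue_measure R).
Implicit Types f g : R -> R.

Lemma integral_EFin_Rint f : integrableR f ->
  (\int[mu]_x (f x)%:E)%E = (\int[mu]_x f x)%:E.
Proof. by move=> hf; rewrite /Rintegral fineK//; exact: integrable_fin_num. Qed.

Let kernel f g (z : R * R) : R := if z.1 <= z.2 then f z.1 * g z.2 else 0.

Let kernel_integrable f g : integrableR f -> integrableR g ->
  (mu \x mu)%E.-integrable setT (EFin \o kernel f g).
Proof.
move=> hf hg.
have mf : measurable_fun setT (fun z : R * R => f z.1).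
  by apply: measurableT_comp => //; exact: integrableR_measurable.
have mg : measurable_fun setT (fun z : R * R => g z.2).
  by apply: measurableT_comp => //; exact: integrableR_measurable.
have mfg : measurable_fun setT (fun z : R * R => f z.1 * g z.2).
  exact: measurable_funM.
have hp : (mu \x mu)%E.-integrable setT (fun z : R * R => (f z.1 * g z.2)%:E).
  apply/integrable12ltyP; first exact/measurable_EFinP.
  rewrite (_ : (fun x => _) = fun x => (`|f x| * \int[mu]_y `|g y|)%:E).
    rewrite integral_EFin_Rint ?ltry//; under eq_fun do rewrite mulrC.
    by apply: integrableRZ; apply: integrableR_norm.
  apply/funext => x.
  rewrite EFinM -integral_EFin_Rint; last exact: integrableR_norm.
  rewrite -integralZl//; last exact: integrableR_norm.
  by apply: eq_integral => y _ /=; rewrite normrM EFinM.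
apply: le_integrable hp => //.
- apply/measurable_EFinP; apply: measurable_fun_ifT => //.
  exact: measurable_fun_ler.
- by move=> z _ /=; rewrite lee_fin /kernel; case: ifP => // _;
  rewrite normr0 normr_ge0.
Qed.

(** Fubini for [f x * g y] cut to the half-plane [x <= y]: integrating in [x] first gives
    [prim f y * g y], integrating in [y] first gives [f x] times the part of the integral of [g]
    beyond [x]. *)
Lemma prim_by_parts f g : integrableR f -> integrableR g ->
  \int[mu]_x (prim f x * g x) + \int[mu]_x (f x * prim g x) =
  (\int[mu]_x f x) * (\int[mu]_x g x).
Proof.
move=> hf hg.
have h1 : integrableR (fun x => prim f x * g x).
  under eq_fun do rewrite mulrC.
  apply: integrableRM => //; first exact: prim_measurable.
  by move=> x; exact: prim_bound.
have h2 : integrableR (fun x => f x * prim g x).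
  apply: integrableRM => //; first exact: prim_measurable.
  by move=> x; exact: prim_bound.
have e1 x : (\int[mu]_y (kernel f g (x, y))%:E)%E =
    (f x * (\int[mu]_y g y - prim g x))%:E.
  have -> : (fun y => (kernel f g (x, y))%:E) =
      fun y => (f x * (g \_ `[x, +oo[) y)%:E.
    apply/funext => y; rewrite /kernel patchE mem_setE in_itv/= andbT.
    by case: ifP; rewrite ?mulr0.
  have hgx : integrableR (g \_ `[x, +oo[).
    by apply: integrableR_restrict => //; apply: integrableR_on.
  rewrite integral_EFin_Rint; last exact: integrableRZ.
  rewrite RintegralZl// -Rintegral_mkcond -Rintegral_itv_obnd_cbnd; last first.
    exact: integrableR_on.
  by rewrite /prim -set_itvNyy Rintegral_itvB// set_itvNyy.
have e2 y : (\int[mu]_x (kernel f g (x, y))%:E)%E = (prim f y * g y)%:E.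
  have -> : (fun x => (kernel f g (x, y))%:E) =
      fun x => (g y * (f \_ `]-oo, y]) x)%:E.
    apply/funext => x; rewrite /kernel patchE mem_setE in_itv/=.
    by case: ifP; rewrite ?mulr0// mulrC.
  have hfy : integrableR (f \_ `]-oo, y]).
    by apply: integrableR_restrict => //; apply: integrableR_on.
  rewrite integral_EFin_Rint; last exact: integrableRZ.
  by rewrite RintegralZl// -Rintegral_mkcond mulrC.
have := Fubini (kernel_integrable hf hg).
rewrite /=; under eq_integral do rewrite e1.
under [X in _ = X]eq_integral do rewrite e2.
under [X in X = _]eq_integral do rewrite mulrBr mulrC.
have hG : integrableR (fun x => (\int[mu]_y g y) * f x) by exact: integrableRZ.
rewrite !integral_EFin_Rint//; last exact: integrableRB.
by case=> <-; rewrite RintegralB// RintegralZl// mulrC subrK.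
Qed.

End by_parts.

(** * Linear Volterra equations with small kernels *)

Section volterra.
Context {R : realType}.
Notation mu := (@lebesgue_measure R).

Lemma ae_mono (P Q : R -> Prop) : (forall x, P x -> Q x) ->
  {ae mu, forall x, P x} -> {ae mu, forall x, Q x}.
Proof.
move=> PQ; apply: (@filterS _ _ (ae_filter_ringOfSetsType mu)) => x; exact: PQ.
Qed.

Lemma ae_mono2 (P Q T : R -> Prop) : (forall x, P x -> Q x -> T x) ->
  {ae mu, forall x, P x} -> {ae mu, forall x, Q x} -> {ae mu, forall x, T x}.
Proof.
move=> PQ; apply: (@filterS2 _ _ (ae_filter_ringOfSetsType mu)) => x; exact: PQ.
Qed.

Lemma ae_forall_ord n (P : 'I_n -> R -> Prop) :
  (forall i, {ae mu, forall x, P i x}) -> {ae mu, forall x, forall i, P i x}.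
Proof.
move=> hP; have : {ae mu, forall x, forall i, i \in enum 'I_n -> P i x}.
  elim: (enum _) => [|i s]; first by apply: aeW.
  apply: ae_mono2 (hP i) => x Pi IH j; rewrite inE => /orP[/eqP->//|].
  exact: IH.
by apply: ae_mono => x h i; apply: h; rewrite mem_enum.
Qed.

Lemma prim_shift_derive (e : R) (f : R -> R) : integrableR f ->
  {ae mu, forall x, derive1 (fun t => e + prim f t) x = f x}.
Proof.
move=> hf; apply: ae_mono (prim_derive hf) => x [df <-].
rewrite !derive1E (_ : (fun t => _) = cst e \+ prim f)//.
have dc := derivable_cst e x 1.
by rewrite (deriveD dc df) derive_cst add0r.
Qed.

(** A null set is too small to contain an interval of positive length. *)
Lemma ae_itv_ex (P : R -> Prop) (u v : R) : u < v ->
  {ae mu, forall x, u < x < v -> P x} -> exists2 x, u < x < v & P x.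
Proof.
move=> uv [N [mN N0 PN]]; apply: contrapT => nex.
have sN : `]u, v[%classic `<=` N.
  move=> x /=; rewrite in_itv/= => xuv; apply: PN => /(_ xuv) Px.
  by apply: nex; exists x.
have := le_measure mu (mem_set (measurable_itv `]u, v[)) (mem_set mN) sN.
rewrite [leLHS](_ : _ = (v - u)%:E); last first.
  by rewrite /= lebesgue_measure_itv/= lte_fin uv EFinB.
by rewrite [X in (_ <= X)%E]N0 lee_fin subr_le0 leNgt uv.
Qed.

(** Used to find points of a full-measure set near [t], including the case where [t] is an endpoint
    of the interval. *)
Lemma ball_itv_meet (u v t d : R) : u < v -> u <= t -> t <= v -> 0 < d ->
  Num.max u (t - d) < Num.min v (t + d).
Proof.
move=> uv ut tv d0.
by rewrite gt_max !lt_min; apply/andP; split; apply/andP; split; lra.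
Qed.

(** The intervals of centre [u n] and radius [2 * M / 2 ^+ n] are nested, because each radius is the
    allowed step plus the next radius. The supremum of the left ends lies in all of them. *)
Lemma geometric_limit (u : nat -> R) (M : R) :
  (forall n, `|u n.+1 - u n| <= M / 2 ^+ n) ->
  exists l, forall n, `|l - u n| <= 2 * M / 2 ^+ n.
Proof.
move=> hu.
have M0 : 0 <= M by have := hu 0; rewrite expr0 divr1; exact: le_trans.
have step n : 2 * M / 2 ^+ n = M / 2 ^+ n + 2 * M / 2 ^+ n.+1.
  by rewrite exprS; field; rewrite expf_neq0//; lra.
have pos n : 0 <= 2 * M / 2 ^+ n by rewrite divr_ge0 ?exprn_ge0//; lra.
pose lo n := u n - 2 * M / 2 ^+ n.
pose hi n := u n + 2 * M / 2 ^+ n.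
have loS n : lo n <= lo n.+1.
  by have := hu n; rewrite ler_norml /lo step => /andP[]; lra.
have hiS n : hi n.+1 <= hi n.
  by have := hu n; rewrite ler_norml /hi (step n) => /andP[]; lra.
have lo_mono n k : lo n <= lo (n + k)%N.
  by elim: k => [|k IH]; rewrite ?addn0// addnS (le_trans IH).
have hi_mono n k : hi (n + k)%N <= hi n.
  by elim: k => [|k IH]; rewrite ?addn0// addnS (le_trans _ IH).
have lohi n k : lo n <= hi k.
  have [nk|/ltnW kn] := leqP n k.
    rewrite -(subnKC nk); apply: le_trans (lo_mono n (k - n)%N) _.
    by rewrite /lo /hi; have := pos (n + (k - n))%N; lra.
  rewrite -(subnKC kn); apply: le_trans (hi_mono k (n - k)%N).
  by rewrite /lo /hi; have := pos (k + (n - k))%N; lra.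
have hub k : ubound (range lo) (hi k) by move=> _ [n _ <-].
have hs : has_sup (range lo).
  by split; [exists (lo 0), 0|exists (hi 0)].
exists (sup (range lo)) => n; rewrite ler_norml.
have h1 : lo n <= sup (range lo) by apply: ub_le_sup; [exists (hi 0)|exists n].
have h2 : sup (range lo) <= hi n by apply: ge_sup; [exists (lo 0), 0|].
by move: h1 h2; rewrite /lo /hi; lra.
Qed.

Context {N : nat}.
Variables (B : 'I_N -> 'I_N -> R -> R) (F : 'I_N -> R -> R) (c : 'I_N -> R).
Variable s : R.
Hypothesis hB : forall i j, integrableR (B i j).
Hypothesis hF : forall i, integrableR (F i).
Hypothesis hBs : \sum_i \sum_j \int[mu]_x `|B i j x| <= 4^-1.
Hypothesis hs : `|s| <= 1.

Definition bounded_meas (phi : 'I_N -> R -> R) (M : R) :=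
  forall i, measurable_fun setT (phi i) /\ (forall x, `|phi i x| <= M).

Let K (phi : 'I_N -> R -> R) i x := \sum_j B i j x * phi j x + F i x.

(** The Picard map of the integral equation. *)
Let S (phi : 'I_N -> R -> R) i t :=
  c i + prim (K phi i) t - s * \int[mu]_x K phi i x.

Let K_int phi M i : bounded_meas phi M -> integrableR (K phi i).
Proof.
move=> hphi; apply: integrableRD => //; apply: integrableR_sum => j.
by apply: (@integrableRM _ M) => //; have [] := hphi j.
Qed.

Let S_bm phi M : bounded_meas phi M -> exists M', bounded_meas (S phi) M'.
Proof.
move=> hphi.
exists (\sum_i (`|c i| + 2 * \int[mu]_x `|K phi i x|)) => i.
have hK := K_int i hphi; split.
  apply: measurable_funB => //; apply: measurable_funD => //.
  exact: prim_measurable.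
move=> t; have h0 j : 0 <= \int[mu]_x `|K phi j x| by apply: Rintegral_ge0.
rewrite (bigD1 i)//= (@le_trans _ _ (`|c i| + 2 * \int[mu]_x `|K phi i x|))//.
  have h1 := prim_bound t hK.
  have h2 : `|s * \int[mu]_x K phi i x| <= \int[mu]_x `|K phi i x|.
    rewrite normrM -[leRHS]mul1r ler_pM// le_normr_Rintegral//.
  rewrite (le_trans (ler_normB _ _))// (le_trans (lerD (ler_normD _ _) h2))//.
  by lra.
by rewrite lerDl sumr_ge0// => j _; rewrite addr_ge0// mulr_ge0//; exact: h0.
Qed.

(** The kernels have total mass at most 1/4 and [|s| <= 1], so the primitive and the constant term
    each change by at most [d / 4]. *)
Let S_contr phi psi M d : bounded_meas phi M -> bounded_meas psi M ->
  (forall i x, `|phi i x - psi i x| <= d) ->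
  forall i t, `|S phi i t - S psi i t| <= d / 2.
Proof.
move=> hphi hpsi hd i t.
have hK1 := K_int i hphi; have hK2 := K_int i hpsi.
pose D x := K phi i x - K psi i x.
have hD : integrableR D by exact: integrableRB.
pose G x := \sum_j d * `|B i j x|.
have hG : integrableR G.
  by apply: integrableR_sum => j; apply: integrableRZ; apply: integrableR_norm.
have DG x : `|D x| <= G x.
  rewrite /D /K opprD addrACA subrr addr0 -sumrB.
  rewrite (le_trans (ler_norm_sum _ _ _))// ler_sum// => j _.
  by rewrite -mulrBr normrM mulrC ler_wpM2r.
have d0 : 0 <= d by exact: le_trans (hd i t).
have G4 : \int[mu]_x G x <= d / 4.
  rewrite Rint_sum//; last by move=> j; apply: integrableRZ; apply: integrableR_norm.
  rewrite (eq_bigr (fun j => d * \int[mu]_x `|B i j x|)); last first.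
    by move=> j _; rewrite RintegralZl//; apply: integrableR_norm.
  rewrite -mulr_sumr ler_wpM2l// (le_trans _ hBs)// [leRHS](bigD1 i)//= lerDl.
  by apply: sumr_ge0 => j _; apply: sumr_ge0 => k _; apply: Rintegral_ge0.
have h1 : `|prim D t| <= d / 4 by rewrite (le_trans _ G4)// Rint_bound.
have h2 : `|s * \int[mu]_x D x| <= d / 4.
  by rewrite normrM -[leRHS]mul1r ler_pM// (le_trans _ G4)// Rint_bound.
have -> : S phi i t - S psi i t = prim D t - s * \int[mu]_x D x.
  by rewrite /S /D primB// RintegralB//; ring.
by rewrite (le_trans (ler_normB _ _))//; lra.
Qed.

(* s = 0 prescribes the value c at -oo, and s = 1 prescribes it at +oo. *)
Lemma volterra : exists w M, bounded_meas w M /\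
  forall i t, w i t = c i + prim (fun x => \sum_j B i j x * w j x + F i x) t
    - s * \int[mu]_x (\sum_j B i j x * w j x + F i x).
Proof.
pose phi n := iter n S (fun _ _ => 0).
have bphi n : exists M, bounded_meas (phi n) M.
  elim: n => [|n [M hM]]; last exact: S_bm hM.
  by exists 0 => i; split=> [|x]; [exact: measurable_cst|rewrite /= normr0].
(* As [phi 0] vanishes, a bound for [phi 1] bounds the first increment, and the contraction halves
   it at each iteration. *)
have [M hM] := bphi 1%N.
have contr f g d : (exists M, bounded_meas f M) -> (exists M, bounded_meas g M) ->
    (forall i x, `|f i x - g i x| <= d) ->
    forall i t, `|S f i t - S g i t| <= d / 2.
  move=> [M1 h1] [M2 h2]; apply: (@S_contr _ _ (Num.max M1 M2)).
    by move=> i; have [m1 b1] := h1 i; split=> // x; rewrite le_max b1.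
  by move=> i; have [m1 b1] := h2 i; split=> // x; rewrite le_max b1 orbT.
have step n i t : `|phi n.+1 i t - phi n i t| <= M / 2 ^+ n.
  elim: n i t => [|n IH] i t.
    by rewrite expr0 divr1 /= subr0; have [_] := hM i; apply.
  rewrite exprSr invfM mulrA; exact: (contr _ _ _ (bphi n.+1) (bphi n) IH).
have lim i t : exists l, forall n, `|l - phi n i t| <= 2 * M / 2 ^+ n.
  exact: geometric_limit.
pose w i t := xget 0 [set l | forall n, `|l - phi n i t| <= 2 * M / 2 ^+ n].
have wP i t n : `|w i t - phi n i t| <= 2 * M / 2 ^+ n.
  by have := xgetPex 0 (lim i t); apply.
have small e : 0 < e -> exists n0, forall n, (n0 <= n)%N ->
    2 * M / 2 ^+ n <= e.
  move=> e0; have := @cvg_geometric _ (2 * M) (2^-1 : R).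
  rewrite ger0_norm ?invr_ge0// invf_lt1 ?ltr1n// => /(_ isT)/cvgrPdist_le.
  move=> /(_ _ e0)[n0 _ hn0]; exists n0 => n /hn0 /=.
  rewrite sub0r normrN exprVn; apply: le_trans; exact: ler_norm.
have bw : bounded_meas w (2 * M).
  move=> i; split; last first.
    by move=> x; have := wP i x 0; rewrite expr0 divr1 /= subr0.
  apply: (@measurable_fun_cvg _ _ _ _ (fun n => phi n i)).
    by move=> n; have [M' /(_ i)[]] := bphi n.
  move=> x _; apply/cvgrPdist_le => e e0.
  have [n0 hn0] := small e e0.
  by exists n0 => // n /= /hn0; apply: le_trans.
exists w, (2 * M); split=> // i t.
(* The fixed point equation: [w] and [S w] are both close to [phi n.+1] for large [n], the second
   one by contraction. *)
apply/eqP; rewrite -subr_eq0 -normr_le0; apply/ler_addgt0Pr => e e0.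
have e20 : 0 < e / 2 by rewrite divr_gt0.
have [n hn] := small _ e20.
have h1 := contr _ _ _ (bphi n) (ex_intro _ _ bw).
have h2 : `|phi n.+1 i t - S w i t| <= e / 2 / 2.
  by apply: h1 => j x; rewrite distrC (le_trans (wP j x n))// hn.
have h3 : `|w i t - phi n.+1 i t| <= e / 2 by rewrite (le_trans (wP i t n.+1))// hn.
rewrite add0r -(subrKA (phi n.+1 i t)) (le_trans (ler_normD _ _))//.
by rewrite -/(S w i t); lra.
Qed.

End volterra.

(** * Controllability by duality *)

Section control.
Context {R : realType}.
Notation mu := (@lebesgue_measure R).

(** If [f t] were nonzero, [f] would have no zero on a ball around [t], and this ball meets []u, v[]
    in a set of positive measure. *)
Lemma continuous_ae_zero (f : R -> R) (u v t : R) : u < t < v ->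
  {for t, continuous f} -> {ae mu, forall x, u < x < v -> f x = 0} -> f t = 0.
Proof.
move=> /andP[ut tv] cf f0; apply/eqP; apply: contraT => ft0.
have [d /= d0 hd] : \forall y \near t, `|f t - f y| < `|f t|.
  by move/cvgrPdist_lt : cf; apply; rewrite normr_gt0.
have lt_uv : Num.max u (t - d) < Num.min v (t + d).
  by apply: ball_itv_meet => //; [exact: lt_trans tv|exact: ltW|exact: ltW].
have aeP : {ae mu, forall x, Num.max u (t - d) < x < Num.min v (t + d) ->
    f x = 0}.
  move: f0; apply: ae_mono => x hx; rewrite gt_max lt_min.
  by move=> /andP[/andP[ux _] /andP[xv _]]; apply: hx; rewrite ux.
have [y /andP[]] := ae_itv_ex lt_uv aeP.
rewrite gt_max lt_min => /andP[_ y1] /andP[_ y2] fy.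
have /hd : ball t d y by rewrite /ball/= ltr_norml; apply/andP; split; lra.
by rewrite fy subr0 ltxx.
Qed.

Lemma Rint_ge0_eq0 (g : R -> R) : integrableR g -> (forall x, 0 <= g x) ->
  \int[mu]_x g x = 0 -> {ae mu, forall x, g x = 0}.
Proof.
move=> hg g0 ig.
have : ae_eq mu setT (EFin \o g) (cst 0%E).
  apply/ae_eq_integral_abs => //; first by case/integrableP : hg.
  under eq_integral do rewrite gee0_abs ?lee_fin//.
  by rewrite integral_EFin_Rint// ig.
by apply: ae_mono => x /(_ I) [].
Qed.

Context {N : nat}.
Variables (B : 'I_N -> 'I_N -> R -> R) (J : pred 'I_N) (p q : R).
Hypothesis pq : p < q.
Hypothesis hB : forall i j, integrableR (B i j).
Hypothesis hBs : \sum_i \sum_j \int[mu]_x `|B i j x| <= 4^-1.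

Definition state_rhs (w F : 'I_N -> R -> R) i x := \sum_j B i j x * w j x + F i x.
Definition costate_rhs (psi : 'I_N -> R -> R) i x := \sum_j B j i x * psi j x.

Lemma state_rhs_int w F M i : bounded_meas w M -> integrableR (F i) ->
  integrableR (state_rhs w F i).
Proof.
move=> hw hF; apply: integrableRD => //; apply: integrableR_sum => j.
by apply: (@integrableRM _ M) => //; have [] := hw j.
Qed.

Lemma costate_rhs_int psi M i : bounded_meas psi M ->
  integrableR (costate_rhs psi i).
Proof.
move=> hw; apply: integrableR_sum => j.
by apply: (@integrableRM _ M) => //; have [] := hw j.
Qed.

Definition costate_control (psi : 'I_N -> R -> R) (i : 'I_N) (x : R) : R :=
  if J i && (p < x <= q) then psi i x else 0.

Lemma costate_control_bm psi M : 0 <= M -> bounded_meas psi M ->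
  bounded_meas (costate_control psi) M.
Proof.
move=> M0 hpsi i; have [mi bi] := hpsi i; split; last first.
  by move=> x; rewrite /costate_control; case: ifP => //; rewrite normr0.
apply: measurable_fun_ifT => //; apply: measurable_and => //.
apply: measurable_and; first exact: measurable_fun_ltr.
exact: measurable_fun_ler.
Qed.

Lemma bounded_supp_integrable (f : R -> R) M : measurable_fun setT f ->
  (forall x, `|f x| <= M) -> (forall x, ~~ (p < x <= q) -> f x = 0) ->
  integrableR f.
Proof.
move=> mf fM f0.
have -> : f = f \_ `]p, q].
  apply/funext => x; rewrite patchE mem_setE in_itv/=.
  by case: ifPn => // /f0.
apply: integrableR_restrict => //; apply: measurable_bounded_integrable => //.
- by rewrite /= lebesgue_measure_itv/= lte_fin pq -EFinD ltry.
- exact: measurable_funTS.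
- exists M; split; first exact: num_real.
  by move=> x Mx y _; rewrite /= (le_trans (fM y))// ltW.
Qed.

Lemma costate_control_int psi M i : bounded_meas psi M ->
  integrableR (costate_control psi i).
Proof.
move=> h; have M0 : 0 <= M by have [_ /(_ 0)] := h i; exact: le_trans.
have [m b] := costate_control_bm M0 h i.
apply: bounded_supp_integrable m b _ => x xpq.
by rewrite /costate_control (negbTE xpq) andbF.
Qed.

(* The costate psi solves psi' = - psi B from psi(-oo) = eta; its components in J,
   used as a control on ]p, q], drive the state w from w(-oo) = - kap to
   w(+oo) = 0. *)
Definition adjoint_pair (eta : 'cV[R]_N) (psi w : 'I_N -> R -> R) (kap : 'cV[R]_N) :=
  [/\ exists M, bounded_meas psi M /\ bounded_meas w M,
      forall i t, psi i t = eta i 0 - prim (costate_rhs psi i) t,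
      forall i t, w i t = prim (state_rhs w (costate_control psi) i) t - kap i 0 &
      forall i, kap i 0 = \int[mu]_x state_rhs w (costate_control psi) i x].

Lemma bounded_meas_le (w : 'I_N -> R -> R) M M' : M <= M' ->
  bounded_meas w M -> bounded_meas w M'.
Proof.
by move=> MM hw i; have [m b] := hw i; split=> // x; exact: le_trans (b x) _.
Qed.

(** Two uses of [volterra]: the costate has the kernel [- B] transposed, which has the same total
    mass, and is prescribed at -oo ([s = 0]); the state is prescribed to be 0 at +oo ([s = 1]). *)
Lemma adjoint_pair_exists eta : exists psi w kap, adjoint_pair eta psi w kap.
Proof.
have hBs' : \sum_i \sum_j \int[mu]_x `|-1 * B j i x| <= 4^-1.
  rewrite exchange_big/=; under eq_bigr do under eq_bigr do
    under eq_Rintegral do rewrite mulN1r normrN.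
  exact: hBs.
have s0 : `|0 : R| <= 1 by rewrite normr0.
have s1 : `|1 : R| <= 1 by rewrite normr1.
have [psi [M [bpsi hpsi]]] := volterra (fun i => eta i 0)
  (fun i j => integrableRZ (-1) (hB j i)) (fun=> integrableR0) hBs' s0.
have [w [M' [bw hw]]] := volterra (fun=> 0) hB
  (fun i => costate_control_int i bpsi) hBs s1.
exists psi, w, (\col_i \int[mu]_x state_rhs w (costate_control psi) i x); split.
- exists (Num.max M M'); split.
    by apply: bounded_meas_le bpsi; rewrite le_max lexx.
  by apply: bounded_meas_le bw; rewrite le_max lexx orbT.
- move=> i t; rewrite hpsi mul0r subr0.
  rewrite (_ : (fun x => _) = fun x => -1 * costate_rhs psi i x).
    by rewrite primZ ?mulN1r//; exact: costate_rhs_int bpsi.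
  apply/funext => x; rewrite addr0 /costate_rhs mulr_sumr.
  by apply: eq_bigr => j _; rewrite mulrA.
- by move=> i t; rewrite mxE hw add0r mul1r.
- by move=> i; rewrite mxE.
Qed.

(** Since [adjoint_pair] is a relation between data and chosen solutions, its linearity is what
    allows [eta] and [kap] to be related by a matrix. *)
Lemma adjoint_pair_lin (k : R) eta psi w kap eta' psi' w' kap' :
  adjoint_pair eta psi w kap -> adjoint_pair eta' psi' w' kap' ->
  adjoint_pair (k *: eta + eta') (fun i x => k * psi i x + psi' i x)
    (fun i x => k * w i x + w' i x) (k *: kap + kap').
Proof.
move=> [[M [b1 b2]] h1 h2 h3] [[M' [b1' b2']] h1' h2' h3'].
have bm f g : bounded_meas f M -> bounded_meas g M' ->
    bounded_meas (fun (i : 'I_N) x => k * f i x + g i x) (`|k| * M + M').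
  move=> hf hg i; have [mf bf] := hf i; have [mg bg] := hg i; split.
    by apply: measurable_funD => //; apply: measurable_funM.
  move=> x; rewrite (le_trans (ler_normD _ _))// lerD// normrM.
  exact: ler_wpM2l.
have eL i : costate_rhs (fun i x => k * psi i x + psi' i x) i =
    fun x => k * costate_rhs psi i x + costate_rhs psi' i x.
  apply/funext => x; rewrite /costate_rhs mulr_sumr -big_split/=.
  by apply: eq_bigr => j _; ring.
have eF i x : costate_control (fun i x => k * psi i x + psi' i x) i x =
    k * costate_control psi i x + costate_control psi' i x.
  by rewrite /costate_control; case: ifP => //; rewrite mulr0 addr0.
have eK i : state_rhs (fun i x => k * w i x + w' i x)
    (costate_control (fun i x => k * psi i x + psi' i x)) i =
    fun x => k * state_rhs w (costate_control psi) i x +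
             state_rhs w' (costate_control psi') i x.
  apply/funext => x; rewrite /state_rhs eF mulrDr mulr_sumr addrACA -big_split/=.
  by congr (_ + _); apply: eq_bigr => j _; ring.
have i1 i := costate_rhs_int i b1; have i1' i := costate_rhs_int i b1'.
have i2 i := state_rhs_int b2 (costate_control_int i b1).
have i2' i := state_rhs_int b2' (costate_control_int i b1').
split.
- by exists (`|k| * M + M'); split; exact: bm.
- move=> i t; rewrite eL primD//; last exact: integrableRZ.
  by rewrite primZ// h1 h1' !mxE; ring.
- move=> i t; rewrite eK primD//; last exact: integrableRZ.
  by rewrite primZ// h2 h2' !mxE; ring.
- move=> i; rewrite eK RintD//; last exact: integrableRZ.
  by rewrite RintZ// -h3 -h3' !mxE.
Qed.

(** The terms in [B] cancel in the derivative of the pairing of [psi] and [w], which leaves the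
    integrand on the left. The pairing is 0 at +oo and minus the right-hand side at -oo;
    [prim_by_parts] makes this rigorous. *)
Lemma adjoint_pair_duality eta psi w kap : adjoint_pair eta psi w kap ->
  \int[mu]_x (\sum_i psi i x * costate_control psi i x) = \sum_i eta i 0 * kap i 0.
Proof.
move=> [[M [b1 b2]] h1 h2 h3].
have i1 i := costate_rhs_int i b1.
have i2 i := state_rhs_int b2 (costate_control_int i b1).
pose L := costate_rhs psi; pose K := state_rhs w (costate_control psi).
have iLw i : integrableR (fun x => L i x * w i x).
  by apply: (@integrableRM _ M) => //; have [] := b2 i.
have iKpsi i : integrableR (fun x => K i x * psi i x).
  by apply: (@integrableRM _ M) => //; have [] := b1 i.
have -> : (fun x => \sum_i psi i x * costate_control psi i x) =
    fun x => \sum_i K i x * psi i x - \sum_i L i x * w i x.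
  apply/funext => x; rewrite /K /L /state_rhs /costate_rhs.
  under [X in _ = X - _]eq_bigr do rewrite mulrDl mulr_suml.
  under [X in _ = _ - X]eq_bigr do rewrite mulr_suml.
  rewrite big_split/= addrAC [X in _ = _ - X + _]exchange_big/=.
  under [X in _ = X - _ + _]eq_bigr do under eq_bigr do rewrite mulrAC.
  by rewrite subrr add0r; apply: eq_bigr => i _; rewrite mulrC.
rewrite RintB; [|exact: integrableR_sum..].
rewrite !Rint_sum// -sumrB; apply: eq_bigr => i _.
have iprimL : integrableR (fun x => prim (L i) x * K i x).
  under eq_fun do rewrite mulrC.
  apply: integrableRM => //; first exact: prim_measurable.
  by move=> x; exact: prim_bound.
have iprimK : integrableR (fun x => L i x * prim (K i) x).
  apply: integrableRM => //; first exact: prim_measurable.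
  by move=> x; exact: prim_bound.
have -> : \int[mu]_x (K i x * psi i x) =
    eta i 0 * kap i 0 - \int[mu]_x (prim (L i) x * K i x).
  rewrite h3 -(RintZ _ (i2 i)) -(RintB (integrableRZ _ (i2 i)) iprimL).
  by apply: eq_Rintegral => x _; rewrite h1 -/K -/L; ring.
have -> : \int[mu]_x (L i x * w i x) =
    \int[mu]_x (L i x * prim (K i) x) - kap i 0 * \int[mu]_x L i x.
  rewrite -(RintZ _ (i1 i)) -(RintB iprimK (integrableRZ _ (i1 i))).
  by apply: eq_Rintegral => x _; rewrite h2 -/K -/L; ring.
have := prim_by_parts (i1 i) (i2 i); rewrite -(h3 i) -/L -/K; lra.
Qed.

End control.

(** * Invertibility of the Gramian and steering *)

Section steering.
Context {R : realType} {N : nat}.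
Notation mu := (@lebesgue_measure R).
Variables (B : 'I_N -> 'I_N -> R -> R) (J : pred 'I_N) (p q : R).
Hypothesis pq : p < q.
Hypothesis hB : forall i j, integrableR (B i j).
Hypothesis hBs : \sum_i \sum_j \int[mu]_x `|B i j x| <= 4^-1.
Hypothesis hobs : forall (eta : 'cV[R]_N) (psi : 'I_N -> R -> R) (M : R),
  bounded_meas psi M ->
  (forall i t, psi i t = eta i 0 - prim (costate_rhs B psi i) t) ->
  (forall i, J i -> forall t, p < t < q -> psi i t = 0) -> eta = 0.

(** The columns of the Gramian [G] are values of [kap] chosen for the basis vectors;
    [adjoint_pair_lin] extends the relation to every [eta]. *)
Let adjoint_pair_mulmx : exists G : 'M[R]_N, forall eta,
  exists psi w, adjoint_pair B J p q eta psi w (G *m eta).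
Proof.
have /choice [kap hkap] : forall k : 'I_N, exists kap, exists psi w,
    adjoint_pair B J p q (delta_mx k 0) psi w kap.
  by move=> k; have [psi [w [kap h]]] := adjoint_pair_exists J pq hB hBs (delta_mx k 0);
    exists kap, psi, w.
exists (\matrix_(i, k) kap k i 0) => eta.
rewrite [X in adjoint_pair _ _ _ _ X](_ : _ = \sum_k eta k 0 *: delta_mx k 0);
  last by rewrite {1}[eta]matrix_sum_delta; apply: eq_bigr => k _; rewrite big_ord1.
have -> : (\matrix_(i, k) kap k i 0) *m eta = \sum_k eta k 0 *: kap k.
  apply/matrixP => i j; rewrite ord1 mxE summxE; apply: eq_bigr => k _.
  by rewrite !mxE mulrC.
elim: (index_enum _) => [|k s [psi [w h]]].
  (* The empty sum requires [kap] to be exactly 0. A pair chosen for [eta = 0] comes with some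
     [kap0], and the difference of this pair with itself has the required value. *)
  rewrite !big_nil; have [psi [w [kap0 h]]] := adjoint_pair_exists J pq hB hBs 0.
  have := adjoint_pair_lin pq hB (-1) h h; rewrite !scaleN1r !addNr => h0.
  by exists (fun i x => -1 * psi i x + psi i x), (fun i x => -1 * w i x + w i x).
have [psi' [w' h']] := hkap k; rewrite !big_cons.
by do 2 eexists; exact: (adjoint_pair_lin pq hB (eta k 0) h' h).
Qed.

(* If eta is in the kernel of G, then duality gives \int \sum_J psi_j^2 = 0. *)
Let gramian_inj (G : 'M[R]_N) :
  (forall eta, exists psi w, adjoint_pair B J p q eta psi w (G *m eta)) -> G \in unitmx.
Proof.
move=> hG; rewrite unitmxE unitfE -det_tr; apply/negP => /det0P[v v0 vG].
have [psi [w h]] := hG v^T.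
have Gv : G *m v^T = 0 by rewrite -[G]trmxK -trmx_mul vG trmx0.
have hd := adjoint_pair_duality pq hB h; move: hd; rewrite Gv.
under [RHS]eq_bigr do rewrite [X in _ * X]mxE mulr0.
rewrite sumr_const mul0rn => hd.
have [[M [b1 b2]] h1 h2 h3] := h.
have ge0 i x : 0 <= psi i x * costate_control J p q psi i x.
  by rewrite /costate_control; case: ifP; rewrite ?mulr0// -expr2 sqr_ge0.
have ig : integrableR (fun x => \sum_i psi i x * costate_control J p q psi i x).
  apply: integrableR_sum => i; under eq_fun do rewrite mulrC.
  have [mi bi] := b1 i.
  exact: integrableRM (costate_control_int J pq i b1) mi bi.
have ae0 := Rint_ge0_eq0 ig (fun x => sumr_ge0 _ (fun i _ => ge0 i x)) hd.
have : v^T = 0.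
  apply: (hobs b1 h1) => i Ji t pqt.
  apply: (continuous_ae_zero pqt).
    rewrite (_ : psi i = (fun t => v^T i 0 - prim (costate_rhs B psi i) t)).
      apply: cvgB; first exact: cvg_cst.
      by apply: prim_continuous; exact: costate_rhs_int b1.
    by apply/funext => x.
  apply: ae_mono ae0 => x /eqP; rewrite psumr_eq0// => /allP/(_ i).
  rewrite mem_index_enum => /(_ isT) /= psi0 /andP[px xq]; move: psi0.
  by rewrite /costate_control Ji px (ltW xq) /= -expr2 sqrf_eq0 => /eqP.
by move/(congr1 trmx); rewrite trmxK trmx0 => v00; rewrite v00 eqxx in v0.
Qed.

Definition admissible_control (F : 'I_N -> R -> R) (M : R) :=
  bounded_meas F M /\ forall i x, ~~ (J i && (p < x <= q)) -> F i x = 0.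

Lemma steer_to_zero (c : 'cV[R]_N) : exists w F M,
  [/\ bounded_meas w M, admissible_control F M,
    forall i t, w i t = c i 0 + prim (state_rhs B w F i) t &
    forall i, \int[mu]_x state_rhs B w F i x = - c i 0].
Proof.
have [G hG] := adjoint_pair_mulmx; have uG := gramian_inj hG.
(* This [eta] is chosen so that [kap = - c], hence the state starts from [- kap = c]. *)
have [psi [w [[M [b1 b2]] h1 h2 h3]]] := hG (invmx G *m - c).
move: h2 h3; rewrite mulKVmx// => h2 h3.
exists w, (costate_control J p q psi), (`|M|).
have b1' := bounded_meas_le (ler_norm M) b1.
split.
- exact: bounded_meas_le (ler_norm M) b2.
- split; first exact: costate_control_bm.
  by move=> i x; rewrite /costate_control => /negbTE->.
- by move=> i t; rewrite h2 mxE opprK addrC.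
- by move=> i; rewrite -h3 mxE.
Qed.

(* Subtract, from a free trajectory ending at d, a controlled one with the same
   initial value that is driven to 0. *)
Lemma steer_from_zero (d : 'cV[R]_N) : exists w F M,
  [/\ bounded_meas w M, admissible_control F M,
    forall i t, w i t = prim (state_rhs B w F i) t &
    forall i, \int[mu]_x state_rhs B w F i x = d i 0].
Proof.
have s1 : `|1 : R| <= 1 by rewrite normr1.
have [v [M1 [bv hv]]] :=
  volterra (fun i => d i 0) hB (fun=> integrableR0) hBs s1.
pose Kv i x := \sum_j B i j x * v j x + 0.
have iKv i : integrableR (Kv i).
  exact: (state_rhs_int (F := fun _ _ => 0) hB bv integrableR0).
have [s [F [M2 [bs [bF F0] hs his]]]] :=
  steer_to_zero (\col_i (d i 0 - \int[mu]_x Kv i x)).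
have iF i : integrableR (F i).
  have [m b] := bF i; apply: (bounded_supp_integrable pq m b) => x xpq.
  by rewrite F0// negb_and xpq orbT.
have iKs i := state_rhs_int hB bs (iF i).
have eK i : state_rhs B (fun j x => v j x - s j x) (fun j x => - F j x) i =
    fun x => Kv i x - state_rhs B s F i x.
  apply/funext => x; rewrite /state_rhs /Kv addr0 opprD addrA -sumrB.
  by congr (_ + _); apply: eq_bigr => j _; rewrite mulrBr.
have M20 : `|M2| <= `|M1| + `|M2| by rewrite lerDr.
exists (fun j x => v j x - s j x), (fun j x => - F j x), (`|M1| + `|M2|); split.
- move=> i; have [m1 n1] := bv i; have [m2 n2] := bs i; split.
    exact: measurable_funB.
  move=> x; rewrite (le_trans (ler_normB _ _))// lerD//.
    by rewrite (le_trans (n1 x))// ler_norm.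
  by rewrite (le_trans (n2 x))// ler_norm.
- split=> [i|i x /F0->]; last by rewrite oppr0.
  have [m b] := bF i; split; first exact: measurableT_comp.
  by move=> x; rewrite normrN (le_trans (b x))// (le_trans (ler_norm _)).
- move=> i t; rewrite eK primB// hv hs mxE -/(Kv i); ring.
- by move=> i; rewrite eK RintB// his mxE; ring.
Qed.

End steering.

(** * Complex systems *)

Section complex_parts.
Context {R : realType}.
Local Notation Re := (@complex.Re R).
Local Notation Im := (@complex.Im R).
Implicit Types z w : R[i].

Lemma complexP z w : Re z = Re w -> Im z = Im w -> z = w.
Proof. by case: z w => [a b] [c d] /= -> ->. Qed.

Lemma ReD z w : Re (z + w) = Re z + Re w. Proof. by case: z; case: w. Qed.
Lemma ImD z w : Im (z + w) = Im z + Im w. Proof. by case: z; case: w. Qed.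
Lemma ReB z w : Re (z - w) = Re z - Re w. Proof. by case: z; case: w. Qed.
Lemma ImB z w : Im (z - w) = Im z - Im w. Proof. by case: z; case: w. Qed.
Lemma ReM z w : Re (z * w) = Re z * Re w - Im z * Im w.
Proof. by case: z; case: w. Qed.
Lemma ImM z w : Im (z * w) = Re z * Im w + Im z * Re w.
Proof. by case: z => a b; case: w => c d /=; rewrite addrC. Qed.

Lemma Re_sum (I : Type) (s : seq I) (F : I -> R[i]) :
  Re (\sum_(i <- s) F i) = \sum_(i <- s) Re (F i).
Proof. by elim: s => [|i s IH]; rewrite ?big_nil// !big_cons ReD IH. Qed.
Lemma Im_sum (I : Type) (s : seq I) (F : I -> R[i]) :
  Im (\sum_(i <- s) F i) = \sum_(i <- s) Im (F i).
Proof. by elim: s => [|i s IH]; rewrite ?big_nil// !big_cons ImD IH. Qed.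

Lemma normC_le z : `|z| <= (`|Re z| + `|Im z|)%:C%C.
Proof.
rewrite normc_def lecR -[leRHS]ger0_norm ?addr_ge0// -sqrtr_sqr ler_wsqrtr//.
rewrite sqrrD !real_normK ?num_real// addrAC lerDl mulrn_wge0// mulr_ge0//.
Qed.

Lemma normC_Re z : `|Re z| <= Re `|z|.
Proof. by have := normc_ge_Re z; rewrite normc_def lecR. Qed.

Lemma normC_Im z : `|Im z| <= Re `|z|.
Proof.
rewrite normc_def /= -sqrtr_sqr ler_wsqrtr// lerDr; exact: sqr_ge0.
Qed.

Lemma measurable_normC (D : set R) (g : R -> R[i]) :
  measurable_fun D (fun x => Re (g x)) -> measurable_fun D (fun x => Im (g x)) ->
  measurable_fun D (fun x => Re `|g x|).
Proof.
move=> mR mI.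
rewrite (_ : (fun x => _) = fun x => Num.sqrt (Re (g x) ^+ 2 + Im (g x) ^+ 2)).
  apply: measurableT_comp.
    by apply: continuous_measurable_fun; exact: sqrt_continuous.
  by apply: measurable_funD; exact: measurable_funX.
by apply/funext => x; rewrite normc_def.
Qed.

End complex_parts.

(** * Real form of the complex system and its observability *)

Section realification.
Context {R : realType} {m : nat}.
Notation mu := (@lebesgue_measure R).
Variables (C : R -> 'M[R[i]]_m) (p q : R).
Hypothesis pq : p < q.

Definition realify (M : 'M[R[i]]_m) : 'M[R]_(m + m) :=
  block_mx (map_mx (@complex.Re R) M) (- map_mx (@complex.Im R) M)
           (map_mx (@complex.Im R) M) (map_mx (@complex.Re R) M).

(* The real system on ]p, q] equivalent to the complex one: the components
   lshift m k and rshift m k are the real and imaginary parts of the k-th one. *)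
Definition real_coef (i j : 'I_(m + m)) (x : R) : R :=
  if p < x <= q then realify (C x) i j else 0.

(** The controlled components: the control enters the last complex equation only, that is, two real
    ones. *)
Definition last_index (i : 'I_(m + m)) : bool :=
  match fintype.split i with inl k => k.+1 == m | inr k => k.+1 == m end.

Lemma last_lshift k : last_index (lshift m k) = (k.+1 == m).
Proof. by rewrite /last_index (fintype.unsplitK (inl k)). Qed.

Lemma last_rshift k : last_index (rshift m k) = (k.+1 == m).
Proof. by rewrite /last_index (fintype.unsplitK (inr k)). Qed.

Lemma realifyE (M : 'M[R[i]]_m) :
  (forall k s, realify M (lshift m k) (lshift m s) = complex.Re (M k s)) *
  (forall k s, realify M (lshift m k) (rshift m s) = - complex.Im (M k s)) *
  (forall k s, realify M (rshift m k) (lshift m s) = complex.Im (M k s)) *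
  (forall k s, realify M (rshift m k) (rshift m s) = complex.Re (M k s)).
Proof.
by split; [split; [split|]|] => k s;
  rewrite /realify ?block_mxEul ?block_mxEur ?block_mxEdl ?block_mxEdr !mxE.
Qed.

Hypothesis C_int : forall i j, integrableR (real_coef i j).
Hypothesis C_struct : {ae mu, forall x, p < x < q -> forall k s : 'I_m,
  ((k.+1 < s)%N -> C x k s = 0) /\ (s = k.+1 :> nat -> C x k s != 0)}.

(** This supplies the hypothesis [hobs] of the steering section. Vanishing propagates from the last
    component down to the first one through the superdiagonal entries, which are nonzero a.e. *)
Lemma real_coef_observable (eta : 'cV[R]_(m + m)) (psi : 'I_(m + m) -> R -> R)
    (M : R) : bounded_meas psi M ->
  (forall i t, psi i t = eta i 0 - prim (costate_rhs real_coef psi i) t) ->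
  (forall i, last_index i -> forall t, p < t < q -> psi i t = 0) -> eta = 0.
Proof.
move=> bpsi hpsi hlast.
have iL i := costate_rhs_int C_int i bpsi.
have cpsi i t : {for t, continuous (psi i)}.
  rewrite (_ : psi i = (fun t => eta i 0 - prim (costate_rhs real_coef psi i) t)).
    by apply: cvgB; [exact: cvg_cst|exact: prim_continuous].
  exact/funext.
have psi_der0 i : (forall t, p < t < q -> psi i t = 0) ->
    {ae mu, forall x, p < x < q -> costate_rhs real_coef psi i x = 0}.
  move=> psi0; apply: ae_mono (prim_derive (iL i)) => x [_ <-] pxq.
  have : \forall y \near x, prim (costate_rhs real_coef psi i) y = eta i 0.
    have : \forall y \near x, y \in `]p, q[ by exact: near_in_itvoo.
    apply: filterS => y; rewrite in_itv/= => /psi0; rewrite hpsi => /eqP.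
    by rewrite subr_eq0 eq_sym => /eqP.
  move/(@near_eq_derive _ _ _ _ (cst (eta i 0)) x 1); rewrite derive1E => ->.
  exact: derive_cst.
(* If components s and above vanish, the equation for psi_s reduces to
   0 = a_{s-1,s} psi_{s-1}. *)
have step n : forall k : 'I_m, (m <= k.+1 + n)%N -> forall t, p < t < q ->
    psi (lshift m k) t = 0 /\ psi (rshift m k) t = 0.
  elim: n => [|n IH] k mk t pqt.
    have kl : k.+1 == m by rewrite eqn_leq ltn_ord -[k.+1]addn0.
    by split; apply: hlast => //; rewrite ?last_lshift ?last_rshift.
  have [km|km] := ltnP k.+1 m; last first.
    have kl : k.+1 == m by rewrite eqn_leq ltn_ord km.
    by split; apply: hlast => //; rewrite ?last_lshift ?last_rshift.
  pose s := Ordinal km.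
  have IHs (j : 'I_m) : (k < j)%N -> forall x, p < x < q ->
      psi (lshift m j) x = 0 /\ psi (rshift m j) x = 0.
    by move=> kj; apply: IH; rewrite (leq_trans mk)// addnS -addSn leq_add2r.
  have hl := psi_der0 _ (fun x hx => (IHs s (ltnSn k) x hx).1).
  have hr := psi_der0 _ (fun x hx => (IHs s (ltnSn k) x hx).2).
  have key : {ae mu, forall x, p < x < q ->
      psi (lshift m k) x = 0 /\ psi (rshift m k) x = 0}.
    have hCl := ae_mono2 (fun x c h => conj c h) C_struct hl.
    apply: ae_mono2 hCl hr => x [Cx hlx] hrx pxq.
    have {Cx} Cx := Cx pxq; have {}hlx := hlx pxq; have {}hrx := hrx pxq.
    have pxq' : p < x <= q by case/andP: pxq => -> /ltW.
    (* Only row [k] of column [s] contributes: the entries above it are zero by the Shin--Zettl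
       structure, and the costates below it vanish by induction. *)
    have z1 j : j != k -> C x j s = 0 \/
        (psi (lshift m j) x = 0 /\ psi (rshift m j) x = 0).
      rewrite neq_ltn => /orP[jk|kj]; last by right; exact: IHs.
      by left; apply: (Cx j s).1.
    move: hlx hrx; rewrite /costate_rhs /real_coef pxq' !big_split_ord/=.
    rewrite (bigD1 k)//= big1 ?addr0; last first.
      by move=> j /z1[e|[e1 e2]]; rewrite realifyE ?e ?e1 /= ?mul0r ?mulr0.
    rewrite (bigD1 k)//= big1 ?addr0; last first.
      by move=> j /z1[e|[e1 e2]]; rewrite realifyE ?e ?e2 /= ?mul0r ?mulr0.
    move=> e1.
    rewrite (bigD1 k)//= big1 ?addr0; last first.
      by move=> j /z1[e|[e1' e2]]; rewrite realifyE ?e ?e1' /= ?oppr0 ?mul0r ?mulr0.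
    rewrite (bigD1 k)//= big1 ?addr0; last first.
      by move=> j /z1[e|[e1' e2]]; rewrite realifyE ?e ?e2 /= ?mul0r ?mulr0.
    move=> e2; move: e1 e2; rewrite !realifyE.
    have := (Cx k s).2 erefl.
    case: (C x k s) => u v /=; set a := psi _ _; set b := psi _ _ => uv0 e1 e2.
    (* The real and imaginary equations form a 2 by 2 system in [a], [b] whose determinant is the
       squared modulus of the superdiagonal entry. *)
    have uv : u ^+ 2 + v ^+ 2 != 0.
      by rewrite paddr_eq0 ?sqr_ge0// !sqrf_eq0; move: uv0; rewrite eq_complex.
    have ha : (u ^+ 2 + v ^+ 2) * a = 0.
      have -> : (u ^+ 2 + v ^+ 2) * a =
          u * (u * a + v * b) - v * (- v * a + u * b) by ring.
      by rewrite e1 e2; ring.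
    have hb : (u ^+ 2 + v ^+ 2) * b = 0.
      have -> : (u ^+ 2 + v ^+ 2) * b =
          v * (u * a + v * b) + u * (- v * a + u * b) by ring.
      by rewrite e1 e2; ring.
    by move/eqP: ha; move/eqP: hb; rewrite !mulf_eq0 (negbTE uv) /= => /eqP-> /eqP->.
  split; apply: (continuous_ae_zero pqt) => //.
    by apply: ae_mono key => x h /h[].
  by apply: ae_mono key => x h /h[].
have psi0 i t : p < t < q -> psi i t = 0.
  move=> pqt; rewrite -(fintype.splitK i); case: (fintype.split i) => k /=.
    by have [] := step m k (leq_addl _ _) t pqt.
  by have [] := step m k (leq_addl _ _) t pqt.
apply/matrixP => i j; rewrite ord1 mxE.
(* At the midpoint [psi] vanishes and also equals [eta]: up to this point the right-hand side is 0,
   by the cut-off before [p] and by [psi0] after it. *)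
have hpq : p < (p + q) / 2 < q by rewrite (midf_lt pq).1 (midf_lt pq).2.
have := psi0 i _ hpq; rewrite hpsi (@prim_left _ _ ((p + q) / 2)) ?subr0//.
move=> x xpq; rewrite /costate_rhs big1// => k _; rewrite /real_coef.
case: ifP => [/andP[px _]|]; last by rewrite mul0r.
have xq : p < x < q by rewrite px /=; move: xpq pq; lra.
by rewrite psi0 ?mulr0.
Qed.

End realification.

(** * Complex trajectories and Borel representatives of the coefficients *)

Section trajectories.
Context {R : realType} {m : nat}.
Notation mu := (@lebesgue_measure R).
Local Notation Re := (@complex.Re R).
Local Notation Im := (@complex.Im R).
Variables (a b : R) (A : R -> 'M[R[i]]_m).

Definition cprimitive (W G : R -> R[i]) :=
  [/\ integrableR (fun x => Re (G x)), integrableR (fun x => Im (G x)) &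
    exists e : R[i], forall t, W t =
      e + (prim (fun x => Re (G x)) t +i* prim (fun x => Im (G x)) t)%C].

Definition cbounded (f : R -> R[i]) :=
  [/\ measurable_fun setT (fun x => Re (f x)),
      measurable_fun setT (fun x => Im (f x)) &
    exists M, forall x, `|Re (f x)| <= M /\ `|Im (f x)| <= M].

(* W solves W' = A W + f, where only the last component of f is nonzero: such
   W are the vectors of quasi-derivatives of W_1, with D^[m] W_1 = f_m. *)
Definition ctrajectory (W : 'I_m -> R -> R[i]) :=
  exists G f : 'I_m -> R -> R[i],
  [/\ forall k, cprimitive (W k) (G k), forall k, cbounded (f k),
      forall k : 'I_m, k.+1 != m -> f k = fun=> 0 &
      ae_on a b (fun x => forall k, G k x = \sum_s A x k s * W s x + f k x)].

Lemma cprimitive0 : cprimitive (fun=> 0) (fun=> 0).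
Proof.
split; try exact: integrableR0.
exists 0 => t; rewrite add0r /= !(@prim_left _ _ t t)//.
Qed.

Lemma ctrajectory0 : ctrajectory (fun _ _ => 0).
Proof.
exists (fun _ _ => 0), (fun _ _ => 0); split=> [k|k|//|].
- exact: cprimitive0.
- by split; [exact: measurable_cst..|exists 0 => x; rewrite normr0].
- by apply: aeW => x _ k; rewrite big1 ?addr0// => s _; rewrite mulr0.
Qed.

Lemma ctrajectoryD W W' : ctrajectory W -> ctrajectory W' ->
  ctrajectory (fun k x => W k x + W' k x).
Proof.
move=> [G [f [hG hf f0 hae]]] [G' [f' [hG' hf' f0' hae']]].
exists (fun k x => G k x + G' k x), (fun k x => f k x + f' k x); split.
- move=> k; have [i1 i2 [e he]] := hG k; have [i1' i2' [e' he']] := hG' k.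
  have eR : (fun x => Re (G k x + G' k x)) = fun x => Re (G k x) + Re (G' k x).
    by apply/funext => x; rewrite ReD.
  have eI : (fun x => Im (G k x + G' k x)) = fun x => Im (G k x) + Im (G' k x).
    by apply/funext => x; rewrite ImD.
  rewrite /cprimitive eR eI; split; try exact: integrableRD.
  exists (e + e') => t; rewrite he he' !primD//.
  by apply: complexP; rewrite !(ReD, ImD) /=; ring.
- move=> k; have [m1 m2 [M hM]] := hf k; have [m1' m2' [M' hM']] := hf' k.
  split.
  + by under eq_fun do rewrite ReD; exact: measurable_funD.
  + by under eq_fun do rewrite ImD; exact: measurable_funD.
  exists (M + M') => x; rewrite ReD ImD; have [h1 h2] := hM x.
  by have [h1' h2'] := hM' x; split; rewrite (le_trans (ler_normD _ _))// lerD.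
- by move=> k km; apply/funext => x; rewrite f0// f0'// addr0.
- apply: ae_mono2 hae hae' => x h h' xab k.
  rewrite h// h'// addrACA -big_split/=; congr (_ + _).
  by apply: eq_bigr => s _; rewrite mulrDr.
Qed.

Lemma in_L1_rep (f : R -> R[i]) : in_Lp 1 a b f -> exists g : R -> R[i],
  [/\ ae_on a b (fun x => f x = g x),
      mu.-integrable `[a, b] (EFin \o (fun x => Re (g x))) &
      mu.-integrable `[a, b] (EFin \o (fun x => Im (g x)))].
Proof.
move=> [g [fg mR mI ig]]; exists g.
have mN := measurable_normC mR mI.
have iN : mu.-integrable `[a, b] (EFin \o (fun x => Re `|g x|)).
  apply/integrableP; split; first exact/measurable_EFinP.
  apply: le_lt_trans ig; rewrite le_eqVlt; apply/orP; left; apply/eqP.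
  apply: eq_integral => x _ /=; rewrite expr1 ger0_norm//.
  by rewrite (le_trans _ (normC_Re _)).
split=> //; apply: le_integrable iN => //.
- exact/measurable_EFinP.
- by move=> x _ /=; rewrite lee_fin (le_trans (normC_Re _))// ler_norm.
- exact/measurable_EFinP.
- by move=> x _ /=; rewrite lee_fin (le_trans (normC_Im _))// ler_norm.
Qed.

Hypothesis ab : a < b.

(** The entries of [A] are integrable only up to a.e. equality. Borel representatives of the
    finitely many entries are collected in [C], and the a.e. structural conditions are transferred
    to it. *)
Lemma shin_zettl_rep : shin_zettl a b A -> exists C : R -> 'M[R[i]]_m,
  [/\ ae_on a b (fun x => A x = C x),
      forall i j, mu.-integrable `[a, b]
        (EFin \o (fun x => realify (C x) i j)) &
      ae_on a b (fun x => forall k s : 'I_m,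
        ((k.+1 < s)%N -> C x k s = 0) /\ (s = k.+1 :> nat -> C x k s != 0))].
Proof.
move=> [A0 A1 Anz].
have /choice [g hg] : forall ks : 'I_m * 'I_m, exists g : R -> R[i],
  [/\ ae_on a b (fun x => A x ks.1 ks.2 = g x),
      mu.-integrable `[a, b] (EFin \o (fun x => Re (g x))) &
      mu.-integrable `[a, b] (EFin \o (fun x => Im (g x)))].
  by move=> [k s]; exact: in_L1_rep.
pose C x := \matrix_(k, s) g (k, s) x.
have AC : ae_on a b (fun x => A x = C x).
  have : {ae mu, forall x, forall k s, `[a, b]%classic x -> A x k s = g (k, s) x}.
    apply: ae_forall_ord => k; apply: ae_forall_ord => s.
    by have [] := hg (k, s).
  by apply: ae_mono => x h xab; apply/matrixP => k s; rewrite mxE h.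
exists C; split=> //.
- move=> i j; rewrite -(fintype.splitK i) -(fintype.splitK j).
  have CR k s : mu.-integrable `[a, b] (EFin \o (fun x => Re (C x k s))).
    by under [X in _ \o X]eq_fun do rewrite mxE; have [] := hg (k, s).
  have CI k s : mu.-integrable `[a, b] (EFin \o (fun x => Im (C x k s))).
    by under [X in _ \o X]eq_fun do rewrite mxE; have [] := hg (k, s).
  case: (fintype.split i) (fintype.split j) => k [] s /=;
    under [X in _ \o X]eq_fun do rewrite realifyE; try exact: CR; try exact: CI.
  by have := integrableN (CI k s); apply: eq_integrable.
- have : {ae mu, forall x, forall k s : 'I_m, `[a, b]%classic x ->
    ((k.+1 < s)%N -> A x k s = 0) /\ (s = k.+1 :> nat -> A x k s != 0)}.
    apply: ae_forall_ord => k; apply: ae_forall_ord => s.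
    have [ks|ks] := ltnP k.+1 s.
      apply: ae_mono (A0 _ _ ks) => x h xab; split=> [_|e]; first exact: h.
      by rewrite e ltnn in ks.
    have [sk|sk] := eqVneq (s : nat) k.+1.
      by apply: ae_mono (Anz _ _ sk) => x h xab; split=> // _; exact: h.
    by apply: aeW => x _; split=> // e; rewrite e eqxx in sk.
  apply: ae_mono2 AC => x hC hA xab k s; rewrite -hC//; exact: hA.
Qed.

End trajectories.

(** * Steering the complex system next to an endpoint *)

Section complex_steering.
Context {R : realType} {m : nat}.
Notation mu := (@lebesgue_measure R).
Local Notation Re := (@complex.Re R).
Local Notation Im := (@complex.Im R).
Variables (a b : R) (A C : R -> 'M[R[i]]_m).
Hypothesis ab : a < b.
Hypothesis AC : ae_on a b (fun x => A x = C x).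
Hypothesis C_int : forall i j, mu.-integrable `[a, b]
  (EFin \o (fun x => realify (C x) i j)).
Hypothesis C_struct : ae_on a b (fun x => forall k s : 'I_m,
  ((k.+1 < s)%N -> C x k s = 0) /\ (s = k.+1 :> nat -> C x k s != 0)).

Lemma real_coef_int p q i j : a <= p -> q <= b -> integrableR (real_coef C p q i j).
Proof.
move=> ap qb.
rewrite (_ : real_coef C p q i j = (fun x => realify (C x) i j) \_ `]p, q]).
  apply: integrableR_restrict => //; apply: integrableS (C_int i j) => //.
  by move=> x /=; rewrite !in_itv/= => /andP[px xq]; apply/andP; split; lra.
by apply/funext => x; rewrite /real_coef patchE mem_setE in_itv.
Qed.

(** The sum of the absolute values of all entries is integrable on [[a, b]]; by absolute continuity
    of its integral, short intervals carry at most the mass 1/4 required for Picard iteration. *)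
Lemma real_coef_small : exists2 d : R, 0 < d & forall p q, a <= p -> q <= b ->
  p < q -> q - p < d ->
  \sum_i \sum_j \int[mu]_x `|real_coef C p q i j x| <= 4^-1.
Proof.
pose B0 i j := (fun x => realify (C x) i j) \_ `[a, b].
have iB0 i j : integrableR (B0 i j) by exact: integrableR_restrict.
pose beta x := \sum_i \sum_j `|B0 i j x|.
have ibeta : integrableR beta.
  apply: integrableR_sum => i; apply: integrableR_sum => j.
  by apply: integrableR_norm.
have e0 : 0 < 4^-1 :> R by rewrite invr_gt0.
have [d [d0 hd]] := integral_normr_continuous ibeta e0.
exists d => // p q ap qb pq qpd.
have iabs i j : integrableR (fun x => `|real_coef C p q i j x|).
  by apply: integrableR_norm; exact: real_coef_int.
under eq_bigr do rewrite -Rint_sum//.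
rewrite -Rint_sum//; last by move=> i; exact: integrableR_sum.
have /(_ (measurable_itv _)) := hd `]p, q]%classic.
rewrite /= lebesgue_measure_itv/= lte_fin pq -EFinB lte_fin qpd => /(_ isT).
move=> /ltW; apply: le_trans; rewrite [leRHS]Rintegral_mkcond.
rewrite le_eqVlt; apply/orP; left; apply/eqP; apply: eq_Rintegral => x _.
rewrite patchE mem_setE in_itv/=; case: ifPn => [pxq|pxq].
  rewrite ger0_norm; last by apply: sumr_ge0 => i _; exact: sumr_ge0.
  apply: eq_bigr => i _; apply: eq_bigr => j _; congr (`| _ |).
  rewrite /real_coef pxq /B0 patchE ifT// mem_setE in_itv/=.
  by move/andP: pxq => [px xq]; apply/andP; split; lra.
rewrite big1// => i _; rewrite big1// => j _.
by rewrite /real_coef (negbTE pxq) normr0.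
Qed.

Lemma real_coef_obs p q (eta : 'cV[R]_(m + m)) (psi : 'I_(m + m) -> R -> R)
    (M : R) : a <= p -> p < q -> q <= b -> bounded_meas psi M ->
  (forall i t, psi i t = eta i 0 - prim (costate_rhs (real_coef C p q) psi i) t) ->
  (forall i, last_index i -> forall t, p < t < q -> psi i t = 0) -> eta = 0.
Proof.
move=> ap pq qb; apply: real_coef_observable => //.
  by move=> i j; exact: real_coef_int.
apply: ae_mono C_struct => x h /andP[px xq]; apply: h.
by rewrite /= in_itv/=; apply/andP; split; lra.
Qed.

(** Outside []p, q]] the real coefficients are cut to 0 whereas [A] is not, so the equation persists
    there because [w] vanishes. *)
Lemma ctrajectory_of_real p q w F M M' (c : 'cV[R]_(m + m)) :
  a <= p -> p < q -> q <= b -> bounded_meas w M ->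
  admissible_control (@last_index m) p q F M' ->
  (forall i t, w i t = c i 0 + prim (state_rhs (real_coef C p q) w F i) t) ->
  (forall x, a < x <= b -> ~~ (p < x <= q) -> forall i, w i x = 0) ->
  ctrajectory a b A (fun k x => (w (lshift m k) x +i* w (rshift m k) x)%C).
Proof.
move=> ap pq qb bw [bF F0] hw w0.
have iF i : integrableR (F i).
  have [mF b0] := bF i; apply: (bounded_supp_integrable pq mF b0) => x xpq.
  by rewrite F0// negb_and xpq orbT.
have iB i j : integrableR (real_coef C p q i j) by exact: real_coef_int.
have iK i := state_rhs_int iB (i := i) bw (iF i).
pose K := state_rhs (real_coef C p q) w F.
exists (fun k x => (K (lshift m k) x +i* K (rshift m k) x)%C),
  (fun k x => (F (lshift m k) x +i* F (rshift m k) x)%C); split.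
- move=> k; split; try exact: iK.
  exists (c (lshift m k) 0 +i* c (rshift m k) 0)%C => t.
  by rewrite !hw.
- move=> k; have [m1 b1] := bF (lshift m k); have [m2 b2] := bF (rshift m k).
  by split=> //=; exists M' => x; split; [exact: b1|exact: b2].
- move=> k km; apply/funext => x.
  by rewrite !F0// ?last_lshift ?last_rshift (negbTE km).
(* When [p = a] the state may be nonzero at [a], where the coefficients are already cut off; this
   single point is discarded as a null set. *)
have nea : {ae mu, forall x, x != a}.
  exists [set a]; split; [exact: measurable_set1|exact: lebesgue_measure_set1|].
  by move=> x /= /negP; rewrite negbK => /eqP.
apply: ae_mono2 AC nea => x hA xa xab k; rewrite hA// {hA}.
move: (xab); rewrite /= in_itv/= => /andP[ax xb].
have axb : a < x <= b by rewrite lt_neqAle eq_sym xa ax xb.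
rewrite /K /state_rhs; have [xpq|xpq] := boolP (p < x <= q); last first.
  have z i : F i x = 0 by rewrite F0// negb_and xpq orbT.
  rewrite !z !big1 ?addr0//.
  - by move=> s _; rewrite !w0// mulr0.
  - by move=> j _; rewrite w0// mulr0.
  - by move=> j _; rewrite w0// mulr0.
apply: complexP; rewrite ?ReD ?ImD ?Re_sum ?Im_sum/=; congr (_ + _);
  rewrite big_split_ord/= -big_split/=; apply: eq_bigr => s _;
  by rewrite ?ReM ?ImM/= /real_coef xpq !realifyE; ring.
Qed.

(** The real state is steered to 0 on []a, q]]. Its right-hand side vanishes elsewhere, so its value
    at [a] is the one at -oo and it is 0 from [q] on. *)
Lemma ctrajectory_left_aux (c : 'I_m -> R[i]) : exists W,
  [/\ ctrajectory a b A W, forall k, W k a = c k &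
    exists2 q, a < q < b & forall k t, q <= t -> W k t = 0].
Proof.
have [d d0 hd] := real_coef_small.
(* The midpoint keeps [q] below [b], and the second bound makes the interval shorter than [d]. *)
pose q := Num.min ((a + b) / 2) (a + d / 2).
have aq : a < q by rewrite lt_min (midf_lt ab).1 ltrDl divr_gt0.
have qb : q < b by rewrite gt_min (midf_lt ab).2.
have qd : q - a < d.
  rewrite ltrBlDl gt_min; apply/orP; right.
  by rewrite ltrD2l ltr_pdivrMr// ltr_pMr// ltr1n.
have iB i j : integrableR (real_coef C a q i j).
  by apply: real_coef_int => //; exact: ltW.
have [] := @steer_to_zero R _ (real_coef C a q) (@last_index m) a q aq iB
  (hd a q (lexx _) (ltW qb) aq qd) _
  (col_mx (\col_k Re (c k)) (\col_k Im (c k))).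
  move=> eta psi M; apply: real_coef_obs => //; exact: ltW.
move=> w [F [M [bw aF hw hI]]].
have K0 i x : ~~ (a < x <= q) -> state_rhs (real_coef C a q) w F i x = 0.
  move=> xaq; rewrite /state_rhs; rewrite aF.2; last by rewrite negb_and xaq orbT.
  rewrite addr0 big1// => j _.
  by rewrite /real_coef (negbTE xaq) mul0r.
have w0 i t : q <= t -> w i t = 0.
  move=> qt; rewrite hw (@prim_right _ _ q)//; first by rewrite hI subrr.
  by move=> x qx; apply: K0; rewrite negb_and -!leNgt -ltNge qx orbT.
exists (fun k x => (w (lshift m k) x +i* w (rshift m k) x)%C); split.
- apply: (ctrajectory_of_real _ aq _ bw aF hw) => //; first exact: ltW.
  move=> x /andP[ax xb]; rewrite ax /= -ltNge => qx i; apply: w0; exact: ltW.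
- move=> k; rewrite !hw !(@prim_left _ _ a)// ?addr0.
  + by rewrite col_mxEu col_mxEd !mxE; case: (c k).
  + by move=> x xa; apply: K0; rewrite negb_and -leNgt xa.
  + by move=> x xa; apply: K0; rewrite negb_and -leNgt xa.
- by exists q; [rewrite aq|move=> k t qt; rewrite !w0].
Qed.

(** Here the state starts from 0 and is steered on []p, b]]; it is 0 up to [p], and its value at [b]
    is the one at +oo. *)
Lemma ctrajectory_right_aux (c : 'I_m -> R[i]) : exists W,
  [/\ ctrajectory a b A W, forall k, W k b = c k &
    exists2 p, a < p < b & forall k t, t <= p -> W k t = 0].
Proof.
have [d d0 hd] := real_coef_small.
pose p := Num.max ((a + b) / 2) (b - d / 2).
have pb : p < b by rewrite gt_max (midf_lt ab).2 ltrBlDr ltrDl divr_gt0.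
have ap : a < p by rewrite lt_max (midf_lt ab).1.
have bd : b - p < d.
  have : b - d / 2 <= p by rewrite le_max lexx orbT.
  by move: d0; lra.
have iB i j : integrableR (real_coef C p b i j).
  by apply: real_coef_int => //; exact: ltW.
have [] := @steer_from_zero R _ (real_coef C p b) (@last_index m) p b pb iB
  (hd p b (ltW ap) (lexx _) pb bd) _
  (col_mx (\col_k Re (c k)) (\col_k Im (c k))).
  move=> eta psi M; apply: real_coef_obs => //; exact: ltW.
move=> w [F [M [bw aF hw hI]]].
have K0 i x : ~~ (p < x <= b) -> state_rhs (real_coef C p b) w F i x = 0.
  move=> xpb; rewrite /state_rhs; rewrite aF.2; last by rewrite negb_and xpb orbT.
  rewrite addr0 big1// => j _.
  by rewrite /real_coef (negbTE xpb) mul0r.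
have w0 i t : t <= p -> w i t = 0.
  move=> tp; rewrite hw (@prim_left _ _ p)//.
  by move=> x xp; apply: K0; rewrite negb_and -leNgt xp.
exists (fun k x => (w (lshift m k) x +i* w (rshift m k) x)%C); split.
- apply: (@ctrajectory_of_real p b w F M M 0 _ pb) => //; first exact: ltW.
    by move=> i t; rewrite mxE add0r.
  by move=> x /andP[ax xb]; rewrite xb andbT -leNgt => xp i; exact: w0.
- move=> k; rewrite !hw !(@prim_right _ _ b)//.
  + by rewrite !hI col_mxEu col_mxEd !mxE; case: (c k).
  + by move=> x bx; apply: K0; rewrite negb_and -!leNgt -ltNge bx orbT.
  + by move=> x bx; apply: K0; rewrite negb_and -!leNgt -ltNge bx orbT.
- by exists p; [rewrite ap|move=> k t tp; rewrite !w0].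
Qed.

End complex_steering.

Lemma ctrajectory_left (R : realType) (m : nat) (a b : R) (A : R -> 'M[R[i]]_m)
    (c : 'I_m -> R[i]) : a < b -> shin_zettl a b A -> exists W,
  [/\ ctrajectory a b A W, forall k, W k a = c k &
    exists2 q, a < q < b & forall k t, q <= t -> W k t = 0].
Proof.
move=> ab /shin_zettl_rep [C [AC iC sC]].
exact: (ctrajectory_left_aux ab AC iC sC).
Qed.

Lemma ctrajectory_right (R : realType) (m : nat) (a b : R) (A : R -> 'M[R[i]]_m)
    (c : 'I_m -> R[i]) : a < b -> shin_zettl a b A -> exists W,
  [/\ ctrajectory a b A W, forall k, W k b = c k &
    exists2 p, a < p < b & forall k t, t <= p -> W k t = 0].
Proof.
move=> ab /shin_zettl_rep [C [AC iC sC]].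
exact: (ctrajectory_right_aux ab AC iC sC).
Qed.

(** * Quasi-derivatives *)

Section quasi_derivative_theory.
Context {R : realType} {m : nat}.
Notation mu := (@lebesgue_measure R).
Local Notation Re := (@complex.Re R).
Local Notation Im := (@complex.Im R).
Variables (a b : R) (A : R -> 'M[R[i]]_m).
Hypothesis ab : a < b.
Implicit Types (f g W G : R -> R[i]).

Lemma cprimitive_abs_cont W G : cprimitive W G -> abs_cont a b W.
Proof.
move=> [iR iI [e0 hW]] e epos.
have e2 : 0 < e / 2 by rewrite divr_gt0.
have [d1 d1p h1] := prim_ac iR e2; have [d2 d2p h2] := prim_ac iI e2.
exists (Num.min d1 d2); first by rewrite lt_min d1p d2p.
move=> N u v huv tI; rewrite lt_min => /andP[s1 s2].
have uv j : u j <= v j by have [] := huv j.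
have := ltrD (h1 N u v uv tI s1) (h2 N u v uv tI s2).
rewrite -splitr -big_split/= => hs.
apply: (@le_lt_trans _ _ (\sum_(j < N) (
   `|prim (fun x => Re (G x)) (v j) - prim (fun x => Re (G x)) (u j)| +
   `|prim (fun x => Im (G x)) (v j) - prim (fun x => Im (G x)) (u j)|)%:C%C)).
  apply: ler_sum => j _; rewrite (le_trans (normC_le _))//.
  rewrite lecR le_eqVlt; apply/orP; left; apply/eqP.
  rewrite ReB ImB !hW !ReD !ImD /=; by congr (_ + _); congr (`| _ |); ring.
by rewrite -(rmorph_sum (real_complex R)) ltcR.
Qed.

Lemma abs_cont_unif f (e : R) : abs_cont a b f -> 0 < e -> exists2 d : R, 0 < d &
  forall x y, a <= x <= b -> a <= y <= b -> `|x - y| < d ->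
    `|f x - f y| < e%:C%C.
Proof.
move=> hf e0; have [d d0 hd] := hf e e0; exists d => // x y.
wlog xy : x y / x <= y => [H hx hy xyd|].
  have [xy|/ltW yx] := leP x y; first exact: H.
  by rewrite distrC; apply: H => //; rewrite distrC.
move=> /andP[ax xb] /andP[ay yb]; rewrite distrC ger0_norm ?subr_ge0// => xyd.
have := hd 1%N (fun=> x) (fun=> y); rewrite !big_ord1 distrC; apply=> //.
by move=> i j _ _ _; rewrite !ord1.
Qed.

(** If [f t] and [g t] differed by [r], both functions would vary by less than [r / 2] near [t], yet
    they agree at some point arbitrarily near [t]. The argument also covers the endpoints of the
    interval. *)
Lemma abs_cont_ae_eq f g u v : abs_cont a b f -> abs_cont a b g ->
  a <= u -> u < v -> v <= b -> {ae mu, forall x, u < x < v -> f x = g x} ->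
  forall t, u <= t <= v -> f t = g t.
Proof.
move=> hf hg au uv vb fg t /andP[ut tv]; apply/eqP; rewrite -subr_eq0.
apply: contraT => fgt.
pose r := Re `|f t - g t|.
have nr : `|f t - g t| = r%:C%C by rewrite /r normc_def.
have r0 : 0 < r.
  by have := fgt; rewrite -normr_gt0 nr (ltcR 0 r).
have r2 : 0 < r / 2 by rewrite divr_gt0.
have [d1 d1p h1] := abs_cont_unif hf r2; have [d2 d2p h2] := abs_cont_unif hg r2.
pose d := Num.min d1 d2.
have d0 : 0 < d by rewrite lt_min d1p d2p.
have lt_uv := ball_itv_meet uv ut tv d0.
have aeP : {ae mu, forall x, Num.max u (t - d) < x < Num.min v (t + d) ->
    f x = g x}.
  move: fg; apply: ae_mono => x hx; rewrite gt_max lt_min.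
  by move=> /andP[/andP[ux _] /andP[xv _]]; apply: hx; rewrite ux.
have [x /andP[]] := ae_itv_ex lt_uv aeP.
rewrite gt_max lt_min => /andP[x1 x2] /andP[x3 x4] fgx.
have tx : `|t - x| < d by rewrite distrC ltr_norml ltrBrDl x2 ltrBlDl x4.
have xab : a <= x <= b by rewrite (le_trans au (ltW x1)) (le_trans (ltW x3) vb).
have tab : a <= t <= b by rewrite (le_trans au ut) (le_trans tv vb).
have t1 : `|t - x| < d1 by apply: lt_le_trans tx _; rewrite ge_min lexx.
have t2 : `|x - t| < d2.
  by rewrite distrC; apply: lt_le_trans tx _; rewrite ge_min lexx orbT.
have := ltrD (h1 t x tab xab t1) (h2 x t xab tab t2).
have -> : (r / 2)%:C%C + (r / 2)%:C%C = r%:C%C :> R[i].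
  by apply: complexP; rewrite ?ReD ?ImD /= ?addr0// -splitr.
rewrite fgx => h.
have := le_lt_trans (ler_normD _ _) h.
by rewrite subrKA nr ltxx.
Qed.

Lemma ae_on_oo (P : R -> Prop) : ae_on a b P ->
  {ae mu, forall x, a < x < b -> P x}.
Proof.
apply: ae_mono => x h /andP[ax xb]; apply: h.
by rewrite /= in_itv/= !ltW.
Qed.

Lemma ae_on_of_oo (P : R -> Prop) : {ae mu, forall x, a < x < b -> P x} ->
  ae_on a b P.
Proof.
have ne c : {ae mu, forall x, x != c}.
  exists [set c]; split; [exact: measurable_set1|exact: lebesgue_measure_set1|].
  by move=> x /= /negP; rewrite negbK => /eqP.
have nab := ae_mono2 (fun x h1 h2 => conj h1 h2) (ne a) (ne b).
apply: ae_mono2 nab => x [xa xb] h; rewrite /= in_itv/= => /andP[ax xb'].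
by apply: h; rewrite lt_neqAle eq_sym xa ax lt_neqAle xb xb'.
Qed.

Lemma ac_version_ae f : abs_cont a b (ac_version a b f) ->
  ae_on a b (fun x => ac_version a b f x = f x).
Proof.
rewrite /ac_version; case: xgetP => [g _ [_ h] //|_ _].
exact: aeW.
Qed.

(** An absolutely continuous representative is unique on [[a, b]] by [abs_cont_ae_eq], so exhibiting
    one identifies [ac_version]. *)
Lemma ac_version_eq f g : abs_cont a b g -> ae_on a b (fun x => g x = f x) ->
  abs_cont a b (ac_version a b f) /\
  forall t, a <= t <= b -> ac_version a b f t = g t.
Proof.
move=> hg gf; rewrite /ac_version; case: xgetP => [h _ [hh hf]|/(_ g)].
  split=> //; apply: abs_cont_ae_eq => //.
  apply: ae_mono2 (ae_on_oo gf) (ae_on_oo hf) => x e1 e2 xab.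
  by rewrite e1// e2.
by case.
Qed.

Lemma cderive_eq_oo f g u v : (forall x, u < x < v -> f x = g x) ->
  forall x, u < x < v -> cderive f x = cderive g x.
Proof.
move=> fg x uxv; have nx : \forall y \near x, f y = g y.
  have : \forall y \near x, y \in `]u, v[ by exact: near_in_itvoo.
  by apply: filterS => y; rewrite in_itv/=; exact: fg.
rewrite /cderive !derive1E; congr (_ +i* _)%C; apply: near_eq_derive;
  by apply: filterS nx => y ->.
Qed.

Lemma cprimitive_cderive W G : cprimitive W G ->
  {ae mu, forall x, cderive W x = G x}.
Proof.
move=> [iR iI [e hW]].
have dR := prim_shift_derive (Re e) iR.
apply: ae_mono2 dR (prim_shift_derive (Im e) iI) => x e1 e2.
have eR : (fun t => Re (W t)) = fun t => Re e + prim (fun x => Re (G x)) t.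
  by apply/funext => t; rewrite hW ReD.
have eI : (fun t => Im (W t)) = fun t => Im e + prim (fun x => Im (G x)) t.
  by apply/funext => t; rewrite hW ImD.
by rewrite /cderive eR eI e1 e2; case: (G x).
Qed.

(** The recursion is local but holds only a.e.; [abs_cont_ae_eq] turns each a.e. equality into
    equality on the closed interval. Hence values at an endpoint depend only on the germ there. *)
Lemma qderiv_local y g u v : a <= u -> u < v -> v <= b ->
  dom_expr a b A y -> dom_expr a b A g ->
  (forall x, u <= x <= v -> y x = g x) ->
  forall k, (k < m)%N -> forall x, u <= x <= v ->
    qderiv a b A y k x = qderiv a b A g k x.
Proof.
move=> au uv vb dy dg yg; elim/ltn_ind => -[|k] IH km x xuv; first exact: yg.
apply: (abs_cont_ae_eq (dy _ km) (dg _ km) au uv vb _ xuv).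
move: (dy _ km) (dg _ km); rewrite !qderivS//.
move=> cy cg.
have hy := ae_on_oo (ac_version_ae cy); have hg := ae_on_oo (ac_version_ae cg).
apply: ae_mono2 hy hg => {xuv}x hy hg /andP[ux xv].
have xab : a < x < b by rewrite (le_lt_trans au ux) (lt_le_trans xv vb).
rewrite (hy xab) (hg xab); congr (_ * (_ - _)).
  apply: (@cderive_eq_oo _ _ u v); last by rewrite ux.
  by move=> z /andP[uz zv]; apply: IH; rewrite ?(ltnW km)// !ltW.
apply: eq_bigr => s _; rewrite (IH s)//; first exact: ltn_trans (ltn_ord s) km.
by rewrite !ltW.
Qed.

Lemma entry_ord (M : 'M[R[i]]_m) (k s : 'I_m) : entry M k s = M k s.
Proof. by rewrite /entry !valK. Qed.

Lemma cbounded_in_L2 f : cbounded f -> in_Lp 2 a b f.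
Proof.
move=> [mR mI [M hM]]; exists f; split.
- exact: aeW.
- exact: measurable_funTS.
- exact: measurable_funTS.
have M0 : 0 <= M by have [h _] := hM 0; exact: le_trans h.
apply: (@le_lt_trans _ _ (\int[mu]_(x in `[a, b]) ((M + M) ^+ 2)%:E)%E); last first.
  rewrite integral_cst//= lebesgue_measure_itv/= lte_fin ab -EFinB -EFinM.
  exact: ltry.
have mN := measurable_normC mR mI.
have N0 x : 0 <= Re `|f x| by rewrite (le_trans _ (normC_Re _)).
apply: ge0_le_integral => //.
- by move=> x _; rewrite lee_fin exprn_ge0.
- by apply/measurable_EFinP; apply: measurable_funTS; exact: measurable_funX.
- move=> x _; rewrite lee_fin ler_pXn2r ?nnegrE ?addr_ge0//.
  have := normC_le (f x); rewrite normc_def lecR => h; rewrite (le_trans h)//.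
  by have [h1 h2] := hM x; exact: lerD.
Qed.

Hypothesis hA : shin_zettl a b A.

Let super_zero : ae_on a b (fun x => forall k s : 'I_m,
  ((k.+1 < s)%N -> A x k s = 0) /\ (s = k.+1 :> nat -> A x k s != 0)).
Proof.
have [C [AC _ hC]] := shin_zettl_rep hA.
by apply: ae_mono2 AC hC => x h1 h2 xab k s; rewrite h1//; exact: h2.
Qed.

(** Passes from the full row sum of a trajectory to the truncated sums of the recursion. It is
    applied with [e] one past the superdiagonal column, and with [e = m] for the last row. *)
Let sum_lower (M : 'M[R[i]]_m) (k : 'I_m) (w : 'I_m -> R[i]) (z : nat -> R[i])
    (e : nat) : (e <= m)%N -> (forall s : 'I_m, (e <= s)%N -> M k s = 0) ->
  (forall s : 'I_m, (s < e)%N -> z s = w s) ->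
  \sum_s M k s * w s = \sum_(s < e) entry M k s * z s.
Proof.
move=> em M0 zw.
rewrite (big_ord_widen m (fun s => entry M k s * z s) em) [RHS]big_mkcond/=.
apply: eq_bigr => s _; case: ltnP => se; first by rewrite entry_ord zw.
by rewrite M0// mul0r.
Qed.

(** Each row of the system but the last, solved for its superdiagonal term, is the recursion
    formula, so the next component of [W] is the absolutely continuous version sought. The last row
    gives the bounded control as [D^[m]] a.e., which is therefore in L_2. *)
Lemma ctrajectory_qderiv (W : 'I_m -> R -> R[i]) (i0 : 'I_m) :
  ctrajectory a b A W -> i0 = 0%N :> nat ->
  op_dom (Lmax a b A) (W i0) /\
  forall (k : 'I_m) x, a <= x <= b -> qderiv a b A (W i0) k x = W k x.
Proof.
move=> [G [f [hG hf f0 hae]]] i00.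
have aeG : {ae mu, forall x, forall k, cderive (W k) x = G k x}.
  by apply: ae_forall_ord => k; exact: cprimitive_cderive.
have hres : {ae mu, forall x, a < x < b -> forall k : 'I_m,
   cderive (W k) x = \sum_s A x k s * W s x + f k x /\ forall s : 'I_m,
   ((k.+1 < s)%N -> A x k s = 0) /\ (s = k.+1 :> nat -> A x k s != 0)}.
  apply: ae_mono2 aeG (ae_mono2 (fun x c h => conj c h) (ae_on_oo hae)
    (ae_on_oo super_zero)) => x h1 [h2 h3] xab k.
  by rewrite h1 h2//; split=> //; exact: h3.
have key k (km : (k < m)%N) : abs_cont a b (qderiv a b A (W i0) k) /\
    forall x, a <= x <= b -> qderiv a b A (W i0) k x = W (Ordinal km) x.
  elim/ltn_ind: k km => -[|k] IH km.
    rewrite qderiv0 (_ : Ordinal km = i0); last exact/val_inj.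
    by split=> //; exact: cprimitive_abs_cont (hG i0).
  have km' : (k < m)%N := ltnW km.
  rewrite qderivS//; apply: ac_version_eq.
    exact: cprimitive_abs_cont (hG (Ordinal km)).
  apply: ae_on_of_oo; apply: ae_mono hres => x hx xab.
  have [hd hz] := hx xab (Ordinal km').
  rewrite (@cderive_eq_oo _ (W (Ordinal km')) a b)//; last first.
    by move=> z /andP[az zb]; apply: (IH k _ km').2; rewrite // !ltW.
  have xab' : a <= x <= b by case/andP: xab => ? ?; rewrite !ltW.
  rewrite hd f0; last by rewrite /= ltn_eqF.
  (* The row sum reaches column [k.+1], whose quasi-derivative is the one being identified; [z] puts
     the component of [W] in its place. *)
  pose z s := if (s == k.+1)%N then W (Ordinal km) x else qderiv a b A (W i0) s x.
  rewrite (@sum_lower _ _ _ z k.+2)//; first last.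
  - move=> s; rewrite ltnS leq_eqVlt /z; case: eqVneq => /= [e _|_ sk].
      by congr (W _ x); apply: val_inj.
    rewrite (IH s sk (ltn_ord s)).2//; congr (W _ x); exact: val_inj.
  - by move=> s ks; exact: (hz s).1.
  rewrite addr0 big_ord_recr/= {2}/z eqxx addrAC.
  rewrite (eq_bigr (fun s : 'I_k.+1 => entry (A x) k s * qderiv a b A (W i0) s x)).
    rewrite subrr add0r mulKf//.
    by rewrite (entry_ord _ (Ordinal km') (Ordinal km)); exact: (hz (Ordinal km)).2.
  by move=> s _; rewrite /z ltn_eqF.
split; last first.
  move=> k x xab; rewrite (key k (ltn_ord k)).2//.
  by congr (W _ x); apply: val_inj.
split; first by move=> k km; exact: (key k km).1.
have mpos : (0 < m)%N by apply: leq_ltn_trans (ltn_ord i0).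
have km : (m.-1 < m)%N by rewrite prednK.
have hlast : qderiv a b A (W i0) m =
    fun x => cderive (qderiv a b A (W i0) m.-1) x -
      \sum_(s < m.-1.+1) entry (A x) m.-1 s * qderiv a b A (W i0) s x.
  by rewrite -qderiv_last ?prednK.
have [g [fg mR mI ig]] := cbounded_in_L2 (hf (Ordinal km)).
exists g; split=> //; rewrite hlast; apply: ae_on_of_oo.
apply: ae_mono2 (ae_on_oo fg) hres => x fgx hx xab; rewrite -(fgx xab).
have [hd _] := hx xab (Ordinal km).
rewrite (@cderive_eq_oo _ (W (Ordinal km)) a b)//; last first.
  by move=> z /andP[az zb]; apply: (key _ km).2; rewrite // !ltW.
have xab' : a <= x <= b by case/andP: xab => ? ?; rewrite !ltW.
rewrite hd (@sum_lower _ _ _ (fun s => qderiv a b A (W i0) s x) m.-1.+1) ?prednK//.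
by rewrite addrAC subrr add0r.
- by move=> s; rewrite leqNgt ltn_ord.
- move=> s _; rewrite (key s (ltn_ord s)).2//; congr (W _ x); exact: val_inj.
Qed.

End quasi_derivative_theory.

(** * Boundary values and separated conditions *)

Section boundary_values.
Context {R : realType} {n : nat}.
Variables (a b : R) (A : R -> 'M[R[i]]_(n + n)).
Hypothesis ab : a < b.
Hypothesis hA : shin_zettl a b A.
Hypothesis n0 : (0 < n)%N.

Let i0 : 'I_(n + n) := Ordinal (ltn_addl n n0).

Lemma qderiv_germ_left g y : dom_expr a b A g -> dom_expr a b A y ->
  germ_eq a b a g y -> forall k, (k < n + n)%N ->
  qderiv a b A g k a = qderiv a b A y k a.
Proof.
move=> dg dy [e /= e0 he] k km.
(* Halving the radius of the ball on which the germs agree leaves a closed interval inside it. *)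
have av : a < Num.min b (a + e / 2) by rewrite lt_min ab ltrDl divr_gt0.
have vb : Num.min b (a + e / 2) <= b by rewrite ge_min lexx.
apply: (qderiv_local (lexx a) av vb dg dy _ km); last by rewrite lexx ltW.
move=> x /andP[ax]; rewrite le_min => /andP[xb xe].
apply: he; last by rewrite /= in_itv/= ax xb.
by rewrite /ball/= distrC ger0_norm ?subr_ge0//; move: xe e0; lra.
Qed.

Lemma qderiv_germ_right g y : dom_expr a b A g -> dom_expr a b A y ->
  germ_eq a b b g y -> forall k, (k < n + n)%N ->
  qderiv a b A g k b = qderiv a b A y k b.
Proof.
move=> dg dy [e /= e0 he] k km.
have ub : Num.max a (b - e / 2) < b.
  by rewrite gt_max ab ltrBlDr ltrDl divr_gt0.
have au : a <= Num.max a (b - e / 2) by rewrite le_max lexx.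
apply: (qderiv_local au ub (lexx b) dg dy _ km); last by rewrite lexx ltW.
move=> x /andP[]; rewrite ge_max => /andP[ax xe] xb.
apply: he; last by rewrite /= in_itv/= ax xb.
by rewrite /ball/= ger0_norm ?subr_ge0//; move: xe e0; lra.
Qed.

(** The recursion selects absolutely continuous versions, so this does not follow by unfolding; the
    zero trajectory identifies them. *)
Lemma qderiv_zero : dom_expr a b A (fun=> 0) /\
  forall k x, (k < n + n)%N -> a <= x <= b -> qderiv a b A (fun=> 0) k x = 0.
Proof.
have [[h _] hq] := ctrajectory_qderiv ab hA (@ctrajectory0 _ _ a b A)
  (erefl (i0 : nat)).
by split=> // k x km; exact: (hq (Ordinal km)).
Qed.

Let sub_lt (k : 'I_n) : (n + n - k.+1 < n + n)%N.
Proof. by rewrite ltn_subrL addn_gt0 n0. Qed.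

Let ltnnn (k : 'I_n) : (k < n + n)%N.
Proof. exact: ltn_addr. Qed.

Let aab : a <= a <= b. Proof. by rewrite lexx ltW. Qed.
Let bab : a <= b <= b. Proof. by rewrite lexx ltW. Qed.

(** The upper halves are values at [a], the lower ones values at [b], and both depend only on the
    germs there. *)
Lemma Gamma_cut_left y g : dom_expr a b A y -> dom_expr a b A g ->
  germ_eq a b a g y -> germ_eq a b b g (fun=> 0) ->
  Gamma1 a b A g = col_mx (usubmx (Gamma1 a b A y)) 0 /\
  Gamma2 a b A g = col_mx (usubmx (Gamma2 a b A y)) 0.
Proof.
move=> dy dg gy g0; have [d0 q0] := qderiv_zero.
have el := qderiv_germ_left dg dy gy; have er := qderiv_germ_right dg d0 g0.
rewrite /Gamma1 /Gamma2 !col_mxKu; split; congr col_mx; apply/matrixP => k j;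
  rewrite !mxE ?el// er// q0// mulr0//.
Qed.

Lemma Gamma_cut_right y h : dom_expr a b A y -> dom_expr a b A h ->
  germ_eq a b a h (fun=> 0) -> germ_eq a b b h y ->
  Gamma1 a b A h = col_mx 0 (dsubmx (Gamma1 a b A y)) /\
  Gamma2 a b A h = col_mx 0 (dsubmx (Gamma2 a b A y)).
Proof.
move=> dy dh h0 hy; have [d0 q0] := qderiv_zero.
have el := qderiv_germ_left dh d0 h0; have er := qderiv_germ_right dh dy hy.
rewrite /Gamma1 /Gamma2 !col_mxKd; split; congr col_mx; apply/matrixP => k j;
  rewrite !mxE ?er// el// q0// mulr0//.
Qed.

(** At one endpoint the two maps read disjoint sets of quasi-derivatives: [Gamma2] those of order
    below [n], [Gamma1] the others in reverse order. Both can thus be prescribed at once, after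
    dividing by the nonzero factors [s k]. *)
Let boundary_data (u v : 'cV[R[i]]_n) (s : nat -> R[i]) :
  (forall k, s k != 0) -> exists c : 'I_(n + n) -> R[i], forall k : 'I_n,
    s k * c (Ordinal (sub_lt k)) = u k 0 /\ c (Ordinal (ltnnn k)) = v k 0.
Proof.
move=> s0.
exists (fun k => match fintype.split k with
  | inl j => v j 0 | inr j => (s (rev_ord j))^-1 * u (rev_ord j) 0 end) => k.
split.
  (* The order [n + n - k.+1] is position [n - k.+1] in the upper range, hence the reversal. *)
  rewrite (_ : Ordinal _ = rshift n (rev_ord k)).
    by rewrite (fintype.unsplitK (inr _)) rev_ordK mulVKf.
  by apply: val_inj; rewrite /= addnBA.
rewrite (_ : Ordinal _ = lshift n k); last exact: val_inj.
by rewrite (fintype.unsplitK (inl _)).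
Qed.

(* y = g + h with g vanishing near b and h vanishing near a. *)
Lemma boundary_triple (u v : 'cV[R[i]]_(n + n)) : exists y g h,
  [/\ op_dom (Lmax a b A) y, op_dom (Lmax a b A) g & op_dom (Lmax a b A) h] /\
  [/\ germ_eq a b a g y, germ_eq a b b g (fun=> 0),
      germ_eq a b a h (fun=> 0) & germ_eq a b b h y] /\
  Gamma1 a b A y = u /\ Gamma2 a b A y = v.
Proof.
have i_neq0 : 'i%C ^+ (n + n) != 0 :> R[i].
  by rewrite expf_neq0// eq_complex/= oner_eq0 andbF.
have [|c hc] := @boundary_data (usubmx u) (usubmx v)
    (fun k => 'i%C ^+ (n + n) * (-1) ^+ k.+1).
  by move=> k; rewrite mulf_neq0// signr_eq0.
have [|d hd] := @boundary_data (dsubmx u) (dsubmx v)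
    (fun k => 'i%C ^+ (n + n) * (-1) ^+ k).
  by move=> k; rewrite mulf_neq0// signr_eq0.
have [W [tW Wa [q /andP[aq qb] Wq]]] := ctrajectory_left c ab hA.
have [V [tV Vb [p /andP[ap pb] Vp]]] := ctrajectory_right d ab hA.
have tWV := ctrajectoryD tW tV.
have [dy qy] := ctrajectory_qderiv ab hA tWV (erefl (i0 : nat)).
have [dg _] := ctrajectory_qderiv ab hA tW (erefl (i0 : nat)).
have [dh _] := ctrajectory_qderiv ab hA tV (erefl (i0 : nat)).
have qya k (km : (k < n + n)%N) :
    qderiv a b A (fun x => W i0 x + V i0 x) k a = c (Ordinal km).
  by rewrite (qy (Ordinal km))// Wa Vp ?addr0// ltW.
have qyb k (km : (k < n + n)%N) :
    qderiv a b A (fun x => W i0 x + V i0 x) k b = d (Ordinal km).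
  by rewrite (qy (Ordinal km))// Vb Wq ?add0r// ltW.
exists (fun x => W i0 x + V i0 x), (W i0), (V i0); split=> //; split.
  have na : \forall x \near within `[a, b]%classic (nbhs a), x <= p.
    by apply: cvg_within; exact: lt_le_nbhsl.
  have nb : \forall x \near within `[a, b]%classic (nbhs b), q <= x.
    by apply: cvg_within; apply: filterS (lt_nbhsr qb) => x /ltW.
  split; rewrite /germ_eq.
  - by apply: filterS na => x xp; rewrite Vp// addr0.
  - by apply: filterS nb => x qx; rewrite Wq.
  - by apply: filterS na => x xp; rewrite Vp.
  - by apply: filterS nb => x qx; rewrite Wq// add0r.
split.
  rewrite -[RHS]vsubmxK; congr col_mx; apply/matrixP => k j; rewrite ord1 mxE.
    by rewrite (qya _ (sub_lt k)); exact: (hc k).1.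
  by rewrite (qyb _ (sub_lt k)); exact: (hd k).1.
rewrite -[RHS]vsubmxK; congr col_mx; apply/matrixP => k j; rewrite ord1 mxE.
  by rewrite (qya _ (ltnnn k)); exact: (hc k).2.
by rewrite (qyb _ (ltnnn k)); exact: (hd k).2.
Qed.

Let cayley (K : 'M[R[i]]_(n + n)) (z : R[i]) (u v : 'cV[R[i]]_(n + n)) :
  ((K - 1%:M) *m u + z *: ((K + 1%:M) *m v) = 0) <->
  K *m (u + z *: v) = u - z *: v.
Proof.
rewrite mulmxBl mulmxDl !mul1mx mulmxDr -scalemxAr scalerDr.
rewrite addrACA.
have -> : K *m u + z *: (K *m v) + (- u + z *: v) =
    (K *m u + z *: (K *m v)) - (u - z *: v) by rewrite opprB [- u + _]addrC.
by split=> [/subr0_eq|->]; rewrite ?subrr.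
Qed.

(** A general nonzero [z] treats both operators at once, with [z] equal to ['i] or to its
    opposite. *)
Lemma separated_block (K : 'M[R[i]]_(n + n)) (z : R[i]) : z != 0 ->
  separated_bc a b (Lmax a b A) (restrict_op (Lmax a b A)
    [set y | (K - 1%:M) *m Gamma1 a b A y
             + z *: ((K + 1%:M) *m Gamma2 a b A y) = 0]) <->
  exists Ka Kb : 'M[R[i]]_n, K = block_mx Ka 0 0 Kb.
Proof.
move=> z0; split=> [sep|[Ka [Kb ->]] y g h [[dy Ly] bcy] [dg Lg] [dh Lh] ga gb ha hb].
  have key (p : 'cV[R[i]]_(n + n)) :
      dlsubmx K *m usubmx p = 0 /\ ursubmx K *m dsubmx p = 0.
    (* The solution of [u + z v = p] and [u - z v = K p]: for boundary values [u], [v] the condition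
       then holds, with [p] arbitrary. *)
    pose u := 2^-1 *: (p + K *m p); pose v := (2 * z)^-1 *: (p - K *m p).
    have [y [g [h [[dy dg dh] [[ga gb ha hb] [yu yv]]]]]] := boundary_triple u v.
    have two0 : (2 : R[i]) != 0 by rewrite pnatr_eq0.
    have zv : z *: v = 2^-1 *: (p - K *m p).
      by rewrite /v scalerA invfM mulrCA mulfV// mulr1.
    have half (w : 'cV[R[i]]_(n + n)) : 2^-1 *: w + 2^-1 *: w = w.
      by rewrite -scalerDl (_ : 2^-1 + 2^-1 = 1) ?scale1r//; field.
    have up : u + z *: v = p.
      by rewrite zv /u -scalerDr addrACA subrr addr0 scalerDr half.
    have uq : u - z *: v = K *m p.
      by rewrite zv /u -scalerBr opprB addrC subrKA scalerDr half.
    have Ly : op_dom (restrict_op (Lmax a b A)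
      [set y | (K - 1%:M) *m Gamma1 a b A y
             + z *: ((K + 1%:M) *m Gamma2 a b A y) = 0]) y.
      by split=> //; apply/cayley; rewrite yu yv up uq.
    have [[_ /cayley Lg] [_ /cayley Lh]] := sep _ _ _ Ly dg dh ga gb ha hb.
    have [g1 g2] := Gamma_cut_left dy.1 dg.1 ga gb.
    have [h1 h2] := Gamma_cut_right dy.1 dh.1 ha hb.
    have upu : usubmx u + z *: usubmx v = usubmx p.
      by rewrite -up; apply/matrixP => i j; rewrite !mxE.
    have upd : dsubmx u + z *: dsubmx v = dsubmx p.
      by rewrite -up; apply/matrixP => i j; rewrite !mxE.
    have uqu : usubmx u - z *: usubmx v = usubmx (K *m p).
      by rewrite -uq; apply/matrixP => i j; rewrite !mxE.
    have uqd : dsubmx u - z *: dsubmx v = dsubmx (K *m p).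
      by rewrite -uq; apply/matrixP => i j; rewrite !mxE.
    (* For [g] the condition says that [K] maps the upper part of [p], padded by 0, to a vector with
       zero lower half; for [h] the halves are exchanged. *)
    move: Lg; rewrite g1 g2 yu yv scale_col_mx scaler0 opp_col_mx !add_col_mx.
    rewrite oppr0 !addr0 upu uqu -{1}[K]submxK mul_block_col !mulmx0 !addr0.
    move=> /eq_col_mx[_ ->].
    move: Lh; rewrite h1 h2 yu yv scale_col_mx scaler0 opp_col_mx !add_col_mx.
    rewrite oppr0 !addr0 upd uqd -{1}[K]submxK mul_block_col !mulmx0 !add0r.
    by move=> /eq_col_mx[-> _].
  have dl0 : dlsubmx K = 0.
    apply/matrixP => i j; have := (key (col_mx (delta_mx j 0) 0)).1.
    by rewrite col_mxKu -colE => /matrixP/(_ i 0); rewrite !mxE.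
  have ur0 : ursubmx K = 0.
    apply/matrixP => i j; have := (key (col_mx 0 (delta_mx j 0))).2.
    by rewrite col_mxKd -colE => /matrixP/(_ i 0); rewrite !mxE.
  by exists (ulsubmx K), (drsubmx K); rewrite -{1}[K]submxK dl0 ur0.
have [g1 g2] := Gamma_cut_left dy dg ga gb.
have [h1 h2] := Gamma_cut_right dy dh ha hb.
(* For a block diagonal [K] the condition splits into one equation at [a] and one at [b]; cutting
   [y] keeps one of them and trivializes the other. *)
move: bcy => /cayley; rewrite -[Gamma1 a b A y]vsubmxK -[Gamma2 a b A y]vsubmxK.
rewrite scale_col_mx opp_col_mx !add_col_mx mul_block_col !mul0mx addr0 add0r.
move=> /eq_col_mx[ea eb].
split; split=> //; apply/cayley; rewrite ?g1 ?g2 ?h1 ?h2.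
  rewrite scale_col_mx scaler0 opp_col_mx oppr0 !add_col_mx !addr0.
  by rewrite mul_block_col !mul0mx !mulmx0 !addr0 ea.
rewrite scale_col_mx scaler0 opp_col_mx oppr0 !add_col_mx !addr0.
by rewrite mul_block_col !mul0mx !mulmx0 !add0r eb.
Qed.

End boundary_values.

Unset Implicit Arguments.

Theorem theorem5 (R : realType) (n : nat) (hn : (2 <= n)%N)
    (a b : R) (hab : a < b)
    (A : R -> 'M[R[i]]_(n + n)) (hA : shin_zettl a b A)
    (hsym : ae_on a b (fun x => A x = formal_adjoint (A x)))
    (K : 'M[R[i]]_(n + n)) :
  (separated_bc a b (Lmax a b A) (L_lower a b A K) <->
     exists Ka Kb : 'M[R[i]]_n, K = block_mx Ka 0 0 Kb) /\
  (separated_bc a b (Lmax a b A) (L_upper a b A K) <->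
     exists Ka Kb : 'M[R[i]]_n, K = block_mx Ka 0 0 Kb).
Proof.
have n0 : (0 < n)%N by exact: ltnW.
have i0 : 'i%C != 0 :> R[i] by rewrite eq_complex/= oner_eq0 andbF.
split; first exact: separated_block.
have -> : L_upper a b A K = restrict_op (Lmax a b A)
    [set y | (K - 1%:M) *m Gamma1 a b A y
             + (- 'i%C) *: ((K + 1%:M) *m Gamma2 a b A y) = 0].
  by congr restrict_op; apply/funext => y /=; rewrite scaleNr.
by apply: separated_block; rewrite ?oppr_eq0.
Qed.
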